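(* Let $R$ be a finite commutative ring with $1\neq 0$ such that $\gamma_a(\Gamma(R))=2$. Then the following equivalences hold: (1) $\psi_g(\Gamma(R))=2$ if and only if $R$ is isomorphic to one of the rings $\mathbb{Z}_2\times \mathbb{Z}_4$, $\mathbb{Z}_2\times \mathbb{Z}_2[X]/(X^2)$, $\mathbb{Z}_3\times \mathbb{Z}_3$, $\mathbb{Z}_3\times \mathbb{F}_4$, $\mathbb{Z}_{25}$, $\mathbb{Z}_5[X]/(X^2)$. (2) $\psi_g(\Gamma(R))=3$ if and only if $R\cong \mathbb{F}_4\times \mathbb{F}_4$.
   Context: $\mathbb{Z}_n=\mathbb{Z}/n\mathbb{Z}$ and $\mathbb{F}_4$ denotes the field with $4$ elements. For a commutative ring $R$ with $1\neq 0$, the zero-divisor graph $\Gamma(R)$ is the simple graph whose vertices are the nonzero zero-divisors of $R$, two distinct vertices $x,y$ being adjacent if and only if $xy=0$. Let $\Gamma=(V,E)$ be a finite simple graph. For $S\subseteq V$ put $\bar S=V\setminus S$ and $\deg_S(x)=|S\cap N(x)|$, where $N(x)$ is the set of vertices adjacent to $x$. A nonempty $S\subseteq V$ is a dominating set if $\deg_S(v)>0$ for every $v\in\bar S$; it is a defensive alliance if $\deg_S(x)+1\ge \deg_{\bar S}(x)$ for every $x\in S$; it is a global defensive alliance if it is both. The global defensive alliance partition number $\psi_g(\Gamma)$ is the maximum number of sets in a partition of $V$ such that each set is a global defensive alliance. The global defensive alliance number $\gamma_a(\Gamma)$ is the minimum cardinality of a global defensive alliance in $\Gamma$. *)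

(* Defs.v *)
From HB Require Import structures.
From mathcomp Require Import all_boot all_algebra all_field.
Set Implicit Arguments.
Unset Strict Implicit.
Unset Printing Implicit Defensive.

Import GRing.Theory.
Local Open Scope ring_scope.

Record sgraph := SGraph {
  vertex :> finType;
  adj : rel vertex;
  adj_sym : symmetric adj;
  adj_irrefl : irreflexive adj }.

Section Alliances.
Variable G : sgraph.
Implicit Types (x v : G) (S : {set G}) (P : {set {set G}}).

Definition nbh x : {set G} := [set y | adj x y].

Definition deg_in S x : nat := #|S :&: nbh x|.

Definition dominating S : bool :=
  (S != set0) && [forall v in ~: S, (0 < deg_in S v)%N].

Definition defensive_alliance S : bool :=
  (S != set0) && [forall x in S, (deg_in (~: S) x <= deg_in S x + 1)%N].

Definition global_defensive_alliance S : bool :=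
  dominating S && defensive_alliance S.

Lemma gda_setT : (0 < #|G|)%N -> global_defensive_alliance setT.
Proof.
move=> G_gt0; have nz : [set: G] != set0 by rewrite -card_gt0 cardsT.
apply/andP; split; apply/andP; split=> //; apply/forall_inP => v.
  by rewrite setCT in_set0.
by rewrite /deg_in setCT set0I cards0.
Qed.

(* By gda_setT the default value [setT] is itself a global defensive alliance
   when G has a vertex, so this is then a true minimum; on the empty graph,
   which has no alliance at all, the value is 0. *)
Definition gda_number : nat :=
  #|[arg min_(S < [set: G] | global_defensive_alliance S) #|S| ]|.

Definition gda_partition P : bool :=
  partition P [set: G] && [forall S in P, global_defensive_alliance S].

Definition gda_partition_number : nat :=
  \max_(P : {set {set G}} | gda_partition P) #|P|.

End Alliances.

Section ZeroDivisorGraph.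
Variable R : finComNzRingType.

Definition zero_divisor (x : R) : bool := [exists y : R, (y != 0) && (x * y == 0)].

Definition zdg_vertex : finType := {x : R | (x != 0) && zero_divisor x}.

Definition zdg_adj : rel zdg_vertex :=
  fun x y => (x != y) && (val x * val y == 0).

Lemma zdg_adj_sym : symmetric zdg_adj.
Proof. by move=> x y; rewrite /zdg_adj eq_sym mulrC. Qed.

Lemma zdg_adj_irrefl : irreflexive zdg_adj.
Proof. by move=> x; rewrite /zdg_adj eqxx. Qed.

Definition zero_divisor_graph : sgraph := SGraph zdg_adj_sym zdg_adj_irrefl.

End ZeroDivisorGraph.

Definition ring_isomorphic (R S : nzRingType) : Prop :=
  exists f : {rmorphism R -> S}, bijective f.

Definition GF4 : finFieldType := s2val (@pPrimePowerField 2 2 isT isT).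

Lemma card_GF4 : #|GF4| = 4%N.
Proof. exact: (s2valP' (@pPrimePowerField 2 2 isT isT)). Qed.

(* A[X]/(X^2). *)
Notation dual_numbers A := {poly %/ ('X^2 : {poly A})}.

(* [{poly %/ h}] silently quotients by 'X unless h is monic and nonconstant. *)
Lemma mk_monic_X2 (A : nzRingType) : mk_monic ('X^2 : {poly A}) = 'X^2.
Proof. by rewrite /mk_monic size_polyXn monicXn. Qed.

(* Main.v *)
Require Import Defs.
From HB Require Import structures.
From mathcomp Require Import all_boot all_fingroup all_solvable all_algebra all_field.
From mathcomp Require Import zify ring.
Set Implicit Arguments.
Unset Strict Implicit.
Unset Printing Implicit Defensive.

Import GRing.Theory FinRing.Theory.
Local Open Scope ring_scope.

(* A two-element global defensive alliance {x, y} in Gamma(R) forces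
   #|Gamma| <= 6, since x and y have degree at most 3 and dominate; with more
   than four vertices, x and y are adjacent and every zero-divisor annihilates
   x or y. As all alliances have at least two elements, psi_g >= 2 forces
   #|Gamma| >= 4. So R has 5, 6 or 7 zero-divisors (0 included).
   If R has no nontrivial idempotent, its zero-divisors form an ideal Z; 6 is
   impossible because 2 and 3 would both lie in Z, 7 gives the complete graph
   K_6, and for #|Z| = 5 the annihilators of nonzero elements of Z are all Z,
   whence Z^2 = 0, #|R| = 25.
   Otherwise R = A x B, and counting the zero-divisors leaves only products of
   two fields of order at most 4, and 2 x 4 with one factor of order 4 not a
   field. Conversely the value of psi_g on each ring is bounded above by
   #|Gamma| / 2 and below by an explicit colouring of the vertices. *)

(** * Alliances in graphs *)

(** Counting zero-divisors admits more rings than the theorem lists, and each surplus is removed for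
    its own reason. The ring Z_2 x F_4 survives the whole classification; its graph is a star, in
    which a class avoiding the centre dominates nothing outside itself but the centre, so psi_g is
    at most 1. Products of fields with a factor of order above 4, such as Z_2 x Z_5, fall to the
    degree bound 3. The ring Z_2 x Z_2 x Z_2 meets the bound of seven zero-divisors and falls to
    domination: some three of its zero-divisors cannot be shared out between the annihilators of x
    and y. Abstract rings are matched with F_4 and Z_p[X]/(X^2) by one device: both are free on 1, w
    over the integers modulo p, with w^2 = a0 + b0 w, and such a presentation determines the
    ring. *)

Section GraphIsomorphism.
Variables (G H : sgraph) (f : G -> H).
Hypothesis f_bij : bijective f.
Hypothesis f_adj : forall x y, adj (f x) (f y) = adj x y.

Lemma graph_iso_mem_imset (S : {set G}) x : (f x \in f @: S) = (x \in S).
Proof. exact/mem_imset/bij_inj. Qed.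

Lemma graph_iso_deg_in (S : {set G}) x : deg_in (f @: S) (f x) = deg_in S x.
Proof.
rewrite /deg_in -(card_imset (S :&: nbh x) (bij_inj f_bij)); congr #|pred_of_set _|.
case: (f_bij) => g fK gK; apply/setP => z; rewrite -[z]gK inE.
by rewrite !graph_iso_mem_imset !inE f_adj.
Qed.

Lemma graph_iso_imsetC (S : {set G}) : (f @: (~: S)) = ~: (f @: S).
Proof.
case: (f_bij) => g fK gK; apply/setP => z.
by rewrite -[z]gK inE !graph_iso_mem_imset inE.
Qed.

Lemma graph_iso_gda (S : {set G}) :
  global_defensive_alliance S -> global_defensive_alliance (f @: S).
Proof.
case/andP=> /andP[S0 /forall_inP dS] /andP[_ /forall_inP aS].
have fS0 : f @: S != set0 by rewrite imset_eq0.
apply/andP; split; apply/andP; split=> //; apply/forall_inP => z.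
  by rewrite -graph_iso_imsetC => /imsetP[x Sx ->]; rewrite graph_iso_deg_in dS.
by case/imsetP=> x Sx ->; rewrite -graph_iso_imsetC !graph_iso_deg_in aS.
Qed.

Lemma graph_iso_gda_partition (P : {set {set G}}) :
  gda_partition P -> gda_partition [set f @: (S : {set G}) | S in P].
Proof.
case/andP=> /and3P[/eqP covP /trivIsetP trivP P0] /forall_inP gdaP.
have f_inj := bij_inj f_bij.
apply/andP; split; last first.
  by apply/forall_inP => _ /imsetP[S PS ->]; apply/graph_iso_gda/gdaP.
apply/and3P; split.
- apply/eqP/setP => z; rewrite inE; case: (f_bij) => g fK gK.
  have: g z \in cover P by rewrite covP inE.
  case/bigcupP=> S PS zS; apply/bigcupP; exists (f @: S); first exact: imset_f.
  by rewrite -[z]gK graph_iso_mem_imset.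
- apply/trivIsetP => _ _ /imsetP[S PS ->] /imsetP[T PT ->] neqST.
  rewrite (imset_disjoint f_inj).
  by apply: trivP => //; apply: contraNneq neqST => ->.
- by apply: contra P0 => /imsetP[S PS /eqP]; rewrite eq_sym imset_eq0 => /eqP <-.
Qed.

Lemma graph_iso_leq_gda_partition_number :
  (gda_partition_number G <= gda_partition_number H)%N.
Proof.
apply/bigmax_leqP => P /graph_iso_gda_partition fP.
rewrite -(card_imset P (imset_inj (bij_inj f_bij))).
exact: (@leq_bigmax_cond _ _ (fun Q : {set {set H}} => #|Q|)).
Qed.

End GraphIsomorphism.

Section AllianceNumbers.
Variable G : sgraph.

Lemma deg_inC (S : {set G}) x : (deg_in S x + deg_in (~: S) x = #|nbh x|)%N.
Proof. by rewrite -(cardsID S (nbh x)) setDE /deg_in ![nbh x :&: _]setIC. Qed.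

Lemma gda_numberP : (0 < #|G|)%N ->
  exists2 S : {set G}, global_defensive_alliance S & #|S| = gda_number G.
Proof.
move=> /gda_setT gdaT; rewrite /gda_number.
by case: (arg_minnP (fun S : {set G} => #|S|) gdaT) => S; exists S.
Qed.

Lemma gda_number_min (S : {set G}) :
  global_defensive_alliance S -> (gda_number G <= #|S|)%N.
Proof.
move=> gdaS; have /gda_setT gdaT : (0 < #|G|)%N.
  case/andP: gdaS => /andP[/set0Pn[x _] _] _.
  by apply/card_gt0P; exists x.
by rewrite /gda_number; case: arg_minnP => // S0 _; apply.
Qed.

Lemma gda_number_gt0 : (0 < gda_number G)%N -> (0 < #|G|)%N.
Proof. by move/leq_trans; apply; rewrite /gda_number max_card. Qed.

Lemma gda_partition_card (P : {set {set G}}) :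
  gda_partition P -> (gda_number G * #|P| <= #|G|)%N.
Proof.
case/andP=> partP /forall_inP gdaP; rewrite -cardsT (card_partition partP).
by rewrite mulnC -sum_nat_const; apply: leq_sum => S /gdaP/gda_number_min.
Qed.

Lemma gda_partition_number_le k : (#|G| < gda_number G * k.+1)%N ->
  (gda_partition_number G <= k)%N.
Proof.
move=> ltGk; apply/bigmax_leqP => P /gda_partition_card leP.
have /leq_ltn_trans/(_ ltGk) := leP.
by rewrite ltn_mul2l => /andP[].
Qed.

(** Source of all lower bounds on psi_g. A colour class is defensive at [v] when the degree of [v]
    is at most 2s + 1, with s the number of neighbours of the same colour: degree at most 1 needs
    none, degree at most 3 needs one. *)
Lemma leq_gda_partition_number (k : nat) (c : G -> 'I_k) :
    (forall i, exists v, c v = i) ->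
    (forall v i, i != c v -> exists2 w, adj v w & c w = i) ->
    (forall v, (#|nbh v| <= 1)%N \/
      (#|nbh v| <= 3)%N /\ exists2 w, adj v w & c w = c v) ->
  (k <= gda_partition_number G)%N.
Proof.
move=> c_surj c_dom c_def; pose F i := [set v | c v == i].
have F_neq0 i : F i != set0.
  by have [v cv] := c_surj i; apply/set0Pn; exists v; rewrite inE cv.
have F_inj : injective F.
  move=> i j eqF; have [v cv] := c_surj i.
  have: v \in F j by rewrite -eqF inE cv.
  by rewrite inE cv => /eqP.
suff gdaP : gda_partition [set F i | i in 'I_k].
  rewrite -[k in (k <= _)%N]card_ord -(card_imset 'I_k F_inj).
  exact: (@leq_bigmax_cond _ _ (fun Q : {set {set G}} => #|Q|)).
apply/andP; split; last first.
  apply/forall_inP => _ /imsetP[i _ ->].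
  apply/andP; split; apply/andP; split=> //; apply/forall_inP => v.
    rewrite !inE eq_sym => /c_dom[w vw cw]; apply/card_gt0P; exists w.
    by rewrite !inE cw eqxx.
  rewrite inE => /eqP cv.
  have := deg_inC (F i) v; have [le1 | [le3 [w vw cw]]] := c_def v; first by lia.
  suff: (0 < deg_in (F i) v)%N by lia.
  by apply/card_gt0P; exists w; rewrite !inE cw cv eqxx.
apply/and3P; split.
- apply/eqP/setP => v; rewrite inE; apply/bigcupP.
  by exists (F (c v)); rewrite ?imset_f ?inE.
- apply/trivIsetP => _ _ /imsetP[i _ ->] /imsetP[j _ ->] neq_ij.
  rewrite -setI_eq0; apply/set0Pn => -[v]; rewrite !inE => /andP[/eqP cvi /eqP cvj].
  by rewrite -cvi -cvj eqxx in neq_ij.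
- by apply/imsetP => -[i _ F0]; have := F_neq0 i; rewrite -F0 eqxx.
Qed.

(** Inside the pair, [x] has degree 1 or 0 according to adjacency, and defence allows one more
    neighbour outside than inside: hence 1 + 2 = 3 or 0 + 1 = 1. *)
Lemma gda_number2 : gda_number G = 2%N ->
  exists x y : G, [/\ x != y, forall z, [|| z == x, z == y, adj x z | adj y z]
    & if adj x y then (#|nbh x| <= 3)%N && (#|nbh y| <= 3)%N
      else (#|nbh x| <= 1)%N && (#|nbh y| <= 1)%N].
Proof.
move=> g2; have G_gt0 : (0 < #|G|)%N by apply: gda_number_gt0; rewrite g2.
have [S gdaS] := gda_numberP G_gt0; rewrite g2 => /eqP/cards2P[x [y [neq_xy defS]]].
move: gdaS; rewrite {S}defS => /andP[/andP[_ /forall_inP domS] /andP[_ /forall_inP defS]].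
exists x, y; split=> // [z|].
  have [//|neq_zx] := eqVneq z x; have [//|neq_zy] := eqVneq z y.
  have := domS z; rewrite !inE negb_or neq_zx neq_zy => /(_ isT)/card_gt0P[w].
  rewrite !inE => /andP[/orP[] /eqP ->]; rewrite adj_sym => -> //.
  by rewrite orbT.
have deg_S u v : u != v -> [set u; v] = [set x; y] -> 
    (#|nbh u| <= (adj u v).*2.+1)%N.
  move=> neq_uv eqS; have := defS u; rewrite -eqS !inE eqxx => /(_ isT).
  have := deg_inC [set u; v] u.
  suff -> : deg_in [set u; v] u = adj u v by case: (adj u v); lia.
  have -> : (adj u v : nat) = #|if adj u v then [set v] else set0|.
    by case: (adj u v); rewrite ?cards1 ?cards0.
  congr #|pred_of_set _|; apply/setP => w; rewrite !inE;
    have [->|neq_wu] /= := eqVneq w u.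
    by rewrite adj_irrefl; case: ifP; rewrite !inE ?(negPf neq_uv).
  by have [->|neq_wv] /= := eqVneq w v; case: ifP; rewrite !inE ?eqxx ?(negPf neq_wv).
have := deg_S x y neq_xy erefl; have := deg_S y x;
  rewrite eq_sym => /(_ neq_xy (setUC _ _)).
by rewrite adj_sym; case: ifP => _ -> ->.
Qed.

(** An adjacent pair lies in the union of its own neighbourhoods, so 3 + 3 vertices are all; a
    nonadjacent pair reaches at most 2 + 1 + 1. *)
Lemma gda_number2_card : gda_number G = 2%N -> (#|G| <= 6)%N.
Proof.
case/gda_number2=> x [y [neq_xy dom deg]].
have : [set: G] \subset [set x; y] :|: (nbh x :|: nbh y).
  by apply/subsetP => z _; rewrite !inE orbA -orbA; have := dom z;
    do !case: (_ == _) => //=.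
case: ifP deg => [xy|_] /andP[dx dy].
  have -> : [set x; y] :|: (nbh x :|: nbh y) = nbh x :|: nbh y.
    apply/setUidPr/subsetP => z; rewrite !inE => /orP[]/eqP->; rewrite ?xy ?orbT //.
    by rewrite adj_sym xy orbT.
  by move/subset_leq_card; rewrite cardsT cardsU; lia.
by move/subset_leq_card; rewrite cardsT !cardsU !cards1; lia.
Qed.

Lemma gda_number2_adj : gda_number G = 2%N -> (4 < #|G|)%N ->
  exists x y : G, [/\ adj x y, forall z, adj x z || adj y z,
    (#|nbh x| <= 3)%N & (#|nbh y| <= 3)%N].
Proof.
move=> g2 lt4G; have [x [y [neq_xy dom]]] := gda_number2 g2.
case: ifP => [xy|_] /andP[dx dy].
  exists x, y; split=> // z; have /or4P[/eqP->|/eqP->|->|->] := dom z;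
    rewrite ?orbT ?xy //.
  by rewrite adj_sym xy orbT.
have : [set: G] \subset [set x; y] :|: (nbh x :|: nbh y).
  by apply/subsetP => z _; rewrite !inE orbA -orbA; have := dom z;
    do !case: (_ == _) => //=.
by move/subset_leq_card; rewrite cardsT !cardsU !cards1; lia.
Qed.

(** Of two classes one misses the centre [x]. A vertex outside it needs a neighbour inside it, which
    is not [x], so that vertex is [x]: the other class lies in {x} and is too small. *)
Lemma gda_partition_number_star (x : G) : (1 < gda_number G)%N ->
  (forall y z, adj y z -> (y == x) || (z == x)) -> (gda_partition_number G <= 1)%N.
Proof.
move=> g2 star; apply/bigmax_leqP => P /andP[partP /forall_inP gdaP].
have [covP trivP P0] := and3P partP.
have covPx v : v \in cover P by rewrite (eqP covP) inE.
rewrite leqNgt; apply/negP => /card_gt1P[S1 [S2 [PS1 PS2 neqS]]].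
wlog xS1 : S1 S2 PS1 PS2 neqS / x \notin S1.
  move=> IH; have [xS1|xS1] := boolP (x \in S1); last exact: (IH S1 S2).
  apply: (IH S2 S1) => //; first by rewrite eq_sym.
  have /pred0P/(_ x) /= := trivIsetP trivP _ _ PS1 PS2 neqS.
  by rewrite xS1 /= => ->.
have /andP[/andP[_ /forall_inP domS1] _] := gdaP _ PS1.
have sS2 : S2 \subset [set x].
  apply/subsetP => v vS2; rewrite inE.
  have vS1 : v \notin S1.
    have /pred0P/(_ v) /= := trivIsetP trivP _ _ PS1 PS2 neqS.
    by rewrite vS2 andbT => ->.
  have := domS1 v; rewrite inE vS1 => /(_ isT)/card_gt0P[w].
  rewrite !inE => /andP[wS1 /star/orP[]// /eqP wx].
  by rewrite wx (negPf xS1) in wS1.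
have := leq_trans g2 (gda_number_min (gdaP _ PS2)).
by have := subset_leq_card sS2; rewrite cards1; lia.
Qed.

(** Any split into two pairs works: each vertex has degree 3, a neighbour in its own pair and one in
    the other. *)
Lemma gda_partition_number_K4 : #|G| = 4%N ->
  (forall x y : G, x != y -> adj x y) -> (2 <= gda_partition_number G)%N.
Proof.
move=> G4 complete; have : (2 <= #|[set: G]|)%N by rewrite cardsT G4.
case/card_gt1P=> u [v [_ _ neq_uv]].
pose S b := if b then [set u; v] else ~: [set u; v].
have S2 b : #|S b| = 2.
  by case: b; rewrite /S ?cards2 ?neq_uv //; have := cardsC [set u; v];
    rewrite cards2 neq_uv G4; lia.
have S_mem b w : (w \in S b) = (w \in S true == b) by case: b;
  rewrite /S !inE ?eqb_id ?eqbF_neg.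
have S_other b w : exists2 z, z != w & z \in S b.
  have /card_gt1P[z1 [z2 [z1S z2S neq_z]]] : (1 < #|S b|)%N by rewrite S2.
  by have [<-|] := eqVneq z1 w; [exists z2; rewrite // eq_sym | exists z1].
pose c w : 'I_2 := if w \in S true then ord0 else ord_max.
have c_mem w b : w \in S b -> c w = if b then ord0 else ord_max.
  by rewrite S_mem /c => /eqP->.
have c_ex i w : exists2 z, z != w & c z = i.
  have [z neq_zw zS] := S_other (i == ord0) w; exists z => //; rewrite (c_mem _ _ zS).
  by case: ifP => [/eqP-> //|]; case: i {zS} => [[|[|//]]] ? // _; apply: val_inj.
apply: (@leq_gda_partition_number _ c) => [i|w i _|w].
- by have [z _] := c_ex i u; exists z.
- by have [z neq_zw cz] := c_ex i w; exists z => //; apply: complete; rewrite eq_sym.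
right; split.
  have /subset_leq_card : nbh w \subset ~: [set w].
    by apply/subsetP => z; rewrite !inE; apply: contraTneq => ->; rewrite adj_irrefl.
  by have := cardsC [set w]; rewrite cards1 G4; lia.
by have [z neq_zw cz] := c_ex (c w) w; exists z => //; apply: complete; rewrite eq_sym.
Qed.

End AllianceNumbers.

(** * Ring isomorphisms and zero-divisor graphs *)

Section RingIsomorphism.
Implicit Types R S T : nzRingType.

Lemma ring_isomorphicI R S (f : R -> S) :
  zmod_morphism f -> monoid_morphism f -> bijective f -> ring_isomorphic R S.
Proof.
move=> fB fM f_bij.
pose add := GRing.isZmodMorphism.Build R S f fB.
pose mul := GRing.isMonoidMorphism.Build R S f fM.
by exists (HB.pack_for {rmorphism R -> S} f add mul).
Qed.

Lemma ring_isomorphic_sym R S : ring_isomorphic R S -> ring_isomorphic S R.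
Proof.
case=> f [g fK gK]; apply: (@ring_isomorphicI _ _ g); last by exists f.
  by move=> x y; apply: (can_inj fK); rewrite rmorphB !gK.
split=> [|x y]; apply: (can_inj fK); first by rewrite rmorph1 gK.
by rewrite rmorphM !gK.
Qed.

Lemma ring_isomorphic_trans S R T :
  ring_isomorphic R S -> ring_isomorphic S T -> ring_isomorphic R T.
Proof.
case=> f f_bij [g g_bij]; exists (GRing.RMorphism.clone _ _ (g \o f) _).
exact: bij_comp.
Qed.

Lemma ring_isomorphic_prod R R' S S' : ring_isomorphic R R' ->
  ring_isomorphic S S' -> ring_isomorphic (R * S)%type (R' * S')%type.
Proof.
case=> f [f' fK f'K] [g [g' gK g'K]].
apply: (@ring_isomorphicI _ _ (fun x => (f x.1, g x.2))).
- by move=> x y; rewrite /= !rmorphB.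
- by split=> [|x y]; rewrite /= ?rmorph1 ?rmorphM.
exists (fun y => (f' y.1, g' y.2)) => -[x y] /=; first by rewrite fK gK.
by rewrite f'K g'K.
Qed.

Lemma ring_isomorphic_swap R S :
  ring_isomorphic (R * S)%type (S * R)%type.
Proof.
by apply: (@ring_isomorphicI _ _ (fun x => (x.2, x.1))) => //;
  exists (fun x => (x.2, x.1)); case.
Qed.

End RingIsomorphism.

Section ZeroDivisors.
Variable R : finComNzRingType.
Implicit Types x y z : R.

Lemma zero_divisorP x : reflect (exists2 y, y != 0 & x * y = 0) (zero_divisor x).
Proof.
apply: (iffP existsP) => [[y /andP[y0 /eqP xy0]] | [y y0 xy0]]; exists y => //.
by rewrite y0 xy0 eqxx.
Qed.

Lemma zero_divisor0 : zero_divisor (0 : R).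
Proof. by apply/zero_divisorP; exists 1; rewrite ?oner_neq0 ?mul0r. Qed.

Lemma zero_divisor1 : zero_divisor (1 : R) = false.
Proof. by apply/zero_divisorP => -[y /eqP y0]; rewrite mul1r. Qed.

Lemma zero_divisorMr x y : zero_divisor x -> zero_divisor (x * y).
Proof.
case/zero_divisorP=> z z0 xz0; apply/zero_divisorP; exists z => //.
by rewrite mulrAC xz0 mul0r.
Qed.

Lemma zero_divisorMl x y : zero_divisor y -> zero_divisor (x * y).
Proof. by rewrite mulrC; apply: zero_divisorMr. Qed.

(** Multiplication by [x] is injective, hence surjective on a finite ring, and reaches 1. *)
Lemma regular_unit x : ~~ zero_divisor x -> exists y, x * y = 1.
Proof.
move=> xreg; have mulI : injective (fun y => x * y).
  move=> y z /eqP; rewrite -subr_eq0 -mulrBr => /eqP xyz0; apply/eqP.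
  rewrite -subr_eq0; apply: contraNT xreg => yz0.
  by apply/zero_divisorP; exists (y - z).
by have [g _ gK] := injF_bij mulI; exists (g 1).
Qed.

Definition zdivs : {set R} := [set x | zero_divisor x].
Definition ann x : {set R} := [set y | x * y == 0].

(** The degree of a vertex, counted in the ring itself; [z != x] matters when [x * x = 0]. *)
Definition zdeg x : nat := #|[set z | [&& z != 0, z != x & x * z == 0]]|.

(** The successor accounts for 0, which is a zero-divisor but not a vertex. *)
Lemma card_zdivs : #|zdivs| = #|zero_divisor_graph R|.+1.
Proof.
rewrite (cardsD1 0) inE zero_divisor0 add1n card_sig; congr _.+1.
by apply: eq_card => x; rewrite !inE.
Qed.

Lemma zdg_vertexP x : x != 0 -> zero_divisor x ->
  exists v : zero_divisor_graph R, val v = x.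
Proof.
by move=> x0 xz; have xv : (x != 0) && zero_divisor x; [rewrite x0 | exists (Sub x xv)].
Qed.

Lemma card_nbh (v : zero_divisor_graph R) : #|nbh v| = zdeg (val v).
Proof.
rewrite -(card_imset (nbh v) val_inj); apply: eq_card => z; rewrite inE.
have [v0 _] := andP (valP v).
apply/imsetP/and3P => [[w] | [z0 zv /eqP vz0]].
  rewrite inE => /andP[neq_vw vw0] ->; have [w0 _] := andP (valP w).
  by rewrite w0 vw0 eq_sym -(inj_eq val_inj) in neq_vw *.
have [|w defz] := zdg_vertexP z0.
  by apply/zero_divisorP; exists (val v); rewrite // mulrC.
exists w => //; rewrite inE; apply/andP.
by rewrite -(inj_eq val_inj) /= defz eq_sym vz0 eqxx.
Qed.

Lemma gda_number2_zero_divisors :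
  gda_number (zero_divisor_graph R) = 2%N -> (5 < #|zdivs|)%N ->
  exists x y, [/\ x != 0, y != 0, x * y = 0,
    forall z, zero_divisor z -> z * x = 0 \/ z * y = 0
    & (zdeg x <= 3)%N && (zdeg y <= 3)%N].
Proof.
rewrite card_zdivs ltnS => g2 /(gda_number2_adj g2)[x [y [/andP[_ /eqP xy0] dom dx dy]]].
exists (val x), (val y).
have [x0 _] := andP (valP x); have [y0 _] := andP (valP y).
split=> // [z zz|]; last by rewrite -!card_nbh dx dy.
have [->|z0] := eqVneq z 0; first by rewrite mul0r; left.
have [w <-] := zdg_vertexP z0 zz; rewrite ![val w * _]mulrC.
by case/orP: (dom w) => /andP[_ /eqP]; [left | right].
Qed.

End ZeroDivisors.

Section IsomorphismInvariance.
Variables R S : finComNzRingType.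
Hypothesis RS : ring_isomorphic R S.

Lemma ring_isomorphic_zdg : exists2 f : zero_divisor_graph R -> zero_divisor_graph S,
  bijective f & forall x y, adj (f x) (f y) = adj x y.
Proof.
have [f [g fK gK]] := RS; have f_inj := can_inj fK.
have f_zd x : zero_divisor (f x) = zero_divisor x.
  apply/zero_divisorP/zero_divisorP => -[y y0 xy0].
    exists (g y); first by rewrite -(inj_eq f_inj) gK rmorph0.
    by apply: f_inj; rewrite rmorphM gK rmorph0.
  exists (f y); first by rewrite -(rmorph0 f) (inj_eq f_inj).
  by rewrite -rmorphM xy0 rmorph0.
have f0 x : (f x != 0) = (x != 0) by rewrite -(rmorph0 f) (inj_eq f_inj).
have fP (v : zero_divisor_graph R) : (f (val v) != 0) && zero_divisor (f (val v)).
  by rewrite f0 f_zd (valP v).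
have gP (v : zero_divisor_graph S) : (g (val v) != 0) && zero_divisor (g (val v)).
  by rewrite -f0 -f_zd gK (valP v).
pose F v : zero_divisor_graph S := exist _ (f (val v)) (fP v).
pose F' v : zero_divisor_graph R := exist _ (g (val v)) (gP v).
exists F.
  by exists F' => v; apply: val_inj; rewrite /= ?fK ?gK.
move=> x y; rewrite /adj /= /zdg_adj -!(inj_eq val_inj) /= (inj_eq f_inj).
by rewrite -rmorphM -[in LHS](rmorph0 f) (inj_eq f_inj).
Qed.

Lemma ring_isomorphic_zdivs : #|zdivs R| = #|zdivs S|.
Proof.
have [f f_bij _] := ring_isomorphic_zdg.
by rewrite !card_zdivs (bij_eq_card f_bij).
Qed.

Lemma ring_isomorphic_gda_partition_number_leq :
  (gda_partition_number (zero_divisor_graph R)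
    <= gda_partition_number (zero_divisor_graph S))%N.
Proof.
have [f f_bij f_adj] := ring_isomorphic_zdg.
exact: graph_iso_leq_gda_partition_number f_bij f_adj.
Qed.

Lemma ring_isomorphic_gda_number_leq : (0 < #|zero_divisor_graph R|)%N ->
  (gda_number (zero_divisor_graph S) <= gda_number (zero_divisor_graph R))%N.
Proof.
have [f f_bij f_adj] := ring_isomorphic_zdg; case/gda_numberP=> A gdaA <-.
rewrite -(card_imset A (bij_inj f_bij)); apply: gda_number_min.
exact: graph_iso_gda.
Qed.

End IsomorphismInvariance.

Lemma ring_isomorphic_gda_partition_number (R S : finComNzRingType) :
    ring_isomorphic R S ->
  gda_partition_number (zero_divisor_graph R) = gda_partition_number
    (zero_divisor_graph S).
Proof.
move=> RS; have SR := ring_isomorphic_sym RS; apply/eqP.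
by rewrite eqn_leq !ring_isomorphic_gda_partition_number_leq.
Qed.

Lemma ring_isomorphic_gda_number (R S : finComNzRingType) :
    ring_isomorphic R S -> (0 < gda_number (zero_divisor_graph R))%N ->
  gda_number (zero_divisor_graph S) = gda_number (zero_divisor_graph R).
Proof.
move=> RS /gda_number_gt0 R_gt0; have SR := ring_isomorphic_sym RS.
apply/eqP; rewrite eqn_leq !ring_isomorphic_gda_number_leq //.
by have := ring_isomorphic_zdivs RS; rewrite !card_zdivs => -[<-].
Qed.

(** * Decomposition along an idempotent *)

Section CornerRing.
Variables (R : finComNzRingType) (e : R).

(* The proofs are parameters of the type so that its ring structure, with unit
   [e], can be a canonical instance. *)
Definition corner of e * e = e & e != 0 : Type := {x : R | x * e == x}.

Hypotheses (ee : e * e = e) (e0 : e != 0).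
Local Notation C := (corner ee e0).

HB.instance Definition _ := Finite.on C.
HB.instance Definition _ := SubType.on C.

Fact corner0_subproof : (0 : R) * e == 0. Proof. by rewrite mul0r. Qed.
Fact corner1_subproof : e * e == e. Proof. exact/eqP. Qed.
Fact cornerN_subproof (x : C) : - val x * e == - val x.
Proof. by rewrite mulNr (eqP (valP x)). Qed.
Fact cornerD_subproof (x y : C) : (val x + val y) * e == val x + val y.
Proof. by rewrite mulrDl (eqP (valP x)) (eqP (valP y)). Qed.
Fact cornerM_subproof (x y : C) : (val x * val y) * e == val x * val y.
Proof. by rewrite -mulrA (eqP (valP y)). Qed.

Definition corner0 : C := exist _ 0 corner0_subproof.
Definition corner1 : C := exist _ e corner1_subproof.
Definition cornerN x : C := exist _ (- val x) (cornerN_subproof x).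
Definition cornerD x y : C := exist _ (val x + val y) (cornerD_subproof x y).
Definition cornerM x y : C := exist _ (val x * val y) (cornerM_subproof x y).

Fact cornerDA : associative cornerD.
Proof. by move=> x y z; apply: val_inj; rewrite /= addrA. Qed.
Fact cornerDC : commutative cornerD.
Proof. by move=> x y; apply: val_inj; rewrite /= addrC. Qed.
Fact cornerD0 : left_id corner0 cornerD.
Proof. by move=> x; apply: val_inj; rewrite /= add0r. Qed.
Fact cornerDN : left_inverse corner0 cornerN cornerD.
Proof. by move=> x; apply: val_inj; rewrite /= addNr. Qed.

HB.instance Definition _ := GRing.isZmodule.Build C cornerDA cornerDC cornerD0 cornerDN.

Fact cornerMA : associative cornerM.
Proof. by move=> x y z; apply: val_inj; rewrite /= mulrA. Qed.
Fact cornerMC : commutative cornerM.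
Proof. by move=> x y; apply: val_inj; rewrite /= mulrC. Qed.
Fact cornerM1 : left_id corner1 cornerM.
Proof. by move=> x; apply: val_inj; rewrite /= mulrC (eqP (valP x)). Qed.
Fact cornerMD : left_distributive cornerM +%R.
Proof. by move=> x y z; apply: val_inj; rewrite /= mulrDl. Qed.
Fact corner1_neq0 : corner1 != 0. Proof. by rewrite -(inj_eq val_inj). Qed.

HB.instance Definition _ := GRing.Zmodule_isComNzRing.Build C
  cornerMA cornerMC cornerM1 cornerMD corner1_neq0.

End CornerRing.

(** Peirce decomposition: [x] goes to its components [x * e] and [x * (1 - e)] in the two corners,
    and adding the components is the inverse. *)
Lemma idempotent_decomposition (R : finComNzRingType) (e : R) :
  e * e = e -> e != 0 -> e != 1 ->
  exists A B : finComNzRingType, ring_isomorphic R (A * B)%type.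
Proof.
move=> ee e0 e1; pose f := 1 - e.
have ef : e * f = 0 by rewrite mulrBr mulr1 ee subrr.
have ff : f * f = f by rewrite {1}/f mulrBl mul1r ef subr0.
have f0 : f != 0 by rewrite subr_eq0 eq_sym.
exists (corner ee e0), (corner ff f0).
have pe x : x * e * e == x * e by rewrite -mulrA ee.
have pf x : x * f * f == x * f by rewrite -mulrA ff.
pose phi x : corner ee e0 * corner ff f0 := (exist _ (x * e) (pe x), exist _ (x * f)
  (pf x)).
apply: (@ring_isomorphicI _ _ phi).
- by move=> x y; congr (_, _); apply: val_inj; rewrite /= mulrBl.
- split=> [|x y]; congr (_, _); apply: val_inj; rewrite /= ?mul1r // mulrACA.
    by rewrite ee.
  by rewrite ff.
exists (fun x => val x.1 + val x.2) => [x | [x y]] /=.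
  by rewrite -mulrDr addrC subrK mulr1.
congr (_, _); apply: val_inj => /=; rewrite mulrDl.
  by rewrite (eqP (valP x)) -(eqP (valP y)) -mulrA [f * e]mulrC ef mulr0 addr0.
by rewrite (eqP (valP y)) -(eqP (valP x)) -mulrA ef mulr0 add0r.
Qed.

(** * Presentations of small rings *)

Section Local.
Variable R : finComNzRingType.
Implicit Types x y : R.

(** The powers of [x] are eventually periodic; an exponent beyond the preperiod that is a multiple
    of the period gives an idempotent. *)
Lemma exp_idempotent x : exists2 n, (0 < n)%N & x ^+ n * x ^+ n = x ^+ n.
Proof.
have /injectiveP/injectivePn : ~ injective (fun i : 'I_#|R|.+1 => x ^+ i.+1).
  by move/leq_card; rewrite card_ord ltnn.
case=> i [j neq_ij eq_x].
wlog lt_ij : i j neq_ij eq_x / (i < j)%N.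
  by case: (ltngtP i j) neq_ij => [||/val_inj->]; rewrite ?eqxx // => lt _ IH; 
     [apply: (IH i j) | apply: (IH j i)];
       rewrite // ?ltn_eqF // -(inj_eq val_inj) ?ltn_eqF ?gtn_eqF.
(* Preperiod and period; the shift by one keeps the exponents positive. *)
pose a := i.+1; pose d := (j - i)%N.
have xd m : (a <= m)%N -> x ^+ (m + d) = x ^+ m.
  move=> le_am; rewrite -(subnK le_am) -addnA !exprD; congr (_ * _).
  by rewrite -exprD eq_x; congr (x ^+ _); rewrite /a /d; lia.
have xkd m k : (a <= m)%N -> x ^+ (m + k * d) = x ^+ m.
  move=> le_am; elim: k => [|k IHk]; first by rewrite addn0.
  by rewrite mulSn addnCA addnC xd ?IHk //; lia.
exists (a * d)%N; first by rewrite muln_gt0 subn_gt0.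
by rewrite -exprD xkd // leq_pmulr // subn_gt0.
Qed.

Hypothesis idem01 : forall e : R, e * e = e -> e = 0 \/ e = 1.

(** The idempotent power of [x] is 0 or 1, and 1 is not a multiple of a zero-divisor. *)
Lemma zero_divisor_nilpotent x : zero_divisor x -> exists n, x ^+ n = 0.
Proof.
move=> xz; have [[//|n] _ /idem01[xn0|xn1]] := exp_idempotent x; first by exists n.+1.
by have := zero_divisorMr (x ^+ n) xz; rewrite -exprS xn1 zero_divisor1.
Qed.

(** If [(x + y) * u = 1] and [y * u] kills [z != 0], then [z = x * u * z]. Iterating gives
    [z = (x * u) ^+ n * z], which vanishes because [x * u] is nilpotent. *)
Lemma zero_divisorD x y : zero_divisor x -> zero_divisor y -> zero_divisor (x + y).
Proof.
move=> xz yz; apply: contraT => /regular_unit[u xyu].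
have [n xun] := zero_divisor_nilpotent (zero_divisorMr u xz).
have /zero_divisorP[z z0] := zero_divisorMr u yz.
have -> : y * u = 1 - x * u by rewrite -xyu mulrDl addrC addKr.
move/eqP; rewrite mulrBl mul1r subr_eq0 => /eqP xuz.
suff zE k : z = (x * u) ^+ k * z by rewrite (zE n) xun mul0r eqxx in z0.
by elim: k => [|k IHk]; rewrite ?mul1r // exprSr -mulrA -xuz.
Qed.

End Local.

(** * Lagrange arguments in the additive group *)

Section AdditiveSubgroups.
Variable R : finComNzRingType.
Implicit Types x y : R.

Lemma natr_card (A : {set R}) x : group_set A -> x \in A -> x *+ #|A| = 0.
Proof. by move=> gA Ax; have := expg_cardG (G := Group gA) Ax; rewrite zmodXgE. Qed.

Lemma natr_cardT : #|R|%:R = 0 :> R.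
Proof. by rewrite -cardsT natr_card ?groupP ?inE. Qed.

Lemma ann_group_set x : group_set (ann x).
Proof.
apply/group_setP; split=> [|y z]; rewrite !inE; first by rewrite mulr0.
by rewrite zmodMgE mulrDr => /eqP-> /eqP->; rewrite addr0.
Qed.

Lemma ann_subset_zdivs x : x != 0 -> ann x \subset zdivs R.
Proof.
move=> x0; apply/subsetP => y; rewrite !inE mulrC => /eqP yx0.
by apply/zero_divisorP; exists x.
Qed.

Lemma card_ann_dvdn (A : {set R}) x : group_set A -> ann x \subset A ->
  (#|ann x| %| #|A|)%N.
Proof. by move=> gA; apply: (cardSg (G := Group gA) (H := Group (ann_group_set x))). Qed.

(** First isomorphism theorem for multiplication by [x], an additive morphism with kernel
    [ann x]. *)
Lemma card_ann x : (#|ann x| * #|[set (x * y)%R | y in R]| = #|R|)%N.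
Proof.
have fM : {in [set: R]%G &, {morph (fun y : R => x * y) : y z / (y * z)%g}}.
  by move=> y z _ _; rewrite !zmodMgE mulrDr.
have := card_morphim (Morphism fM) [set: R]%G.
have -> : ('ker (Morphism fM))%g = ann x by apply/setP=> y; rewrite !inE.
rewrite setIid morphimEdom => eq_card; rewrite -[#|R|]cardsT.
rewrite -(Lagrange (subsetT (Group (ann_group_set x)))) -eq_card.
by congr (_ * #|pred_of_set _|)%N; apply/setP=> z; apply/imsetP/imsetP=> -[y _ ->];
  exists y; rewrite ?inE.
Qed.

(** For [x != 0], [ann x] is a subgroup of a group of prime order and does not contain 1, so it is
    trivial. *)
Lemma card_prime_domain : prime #|R| -> forall x, zero_divisor x -> x = 0.
Proof.
move=> prR x /zero_divisorP[y y0 xy0]; apply: contraTeq isT => x0.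
have := card_ann_dvdn (groupP [set: R]%G) (subsetT (ann x)).
rewrite cardsT; case/primeP: (prR) => _ /[apply] /orP[]/eqP annx.
  have /eqP/cards1P[z defx] := annx.
  have: 0 \in ann x by rewrite inE mulr0.
  have: y \in ann x by rewrite inE xy0.
  by rewrite defx !inE => /eqP yz /eqP z0; rewrite yz -z0 eqxx in y0.
have: 1 \in ann x by rewrite (_ : ann x = [set: R]) ?inE //; apply/eqP;
  rewrite eqEcard subsetT cardsT annx /=.
by rewrite inE mulr1 (negPf x0).
Qed.

End AdditiveSubgroups.

(** The isomorphism is built from ['Z_n] to [A], sending a residue to its multiple of 1.
    Characteristic exactly n makes it injective, and the bound on [#|A|] then makes it bijective. *)
Lemma ring_isomorphic_Zn (A : finComNzRingType) (n : nat) :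
    (1 < n)%N -> (#|A| <= n)%N -> (forall k, (k%:R == 0 :> A) = (n %| k)%N) ->
  ring_isomorphic A 'Z_n.
Proof.
case: n => [|[|n]] // _ leAn natr0; set p := n.+2 in leAn natr0 *.
apply: ring_isomorphic_sym; pose f (x : 'Z_p) : A := (val x)%:R.
have p0 : p%:R = 0 :> A by apply/eqP; rewrite natr0.
have natr_mod k : (k %% p)%:R = k%:R :> A.
  by rewrite [in RHS](divn_eq k p) natrD natrM p0 mulr0 add0r.
have fD x y : f (x + y) = f x + f y by rewrite /f -natrD -(natr_mod (_ + _)%N).
have fM x y : f (x * y) = f x * f y by rewrite /f -natrM -(natr_mod (_ * _)%N).
apply: (@ring_isomorphicI _ _ f) => [x y|//|].
  by apply/eqP; rewrite eq_sym subr_eq -fD subrK.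
apply: inj_card_bij; last by rewrite card_ord.
move=> x y; wlog le_xy : x y / (x <= y)%N.
  by move=> IH; case/orP: (leq_total x y) => le eq_f; last apply/esym; apply: IH.
move=> eq_f; apply: val_inj; apply/eqP; rewrite eqn_leq le_xy /= -subn_eq0.
have : (p %| val y - val x)%N by rewrite -natr0 natrB // -/(f y) -/(f x) eq_f subrr.
by move/eqP: (ltn_ord y) => /= lty; rewrite /dvdn modn_small //; have := ltn_ord y;
  rewrite /= -/p; lia.
Qed.

(** * Rings with a basis 1, w over the integers modulo p *)

Section QuadraticExtension.
Variables (p a0 b0 : nat).
Hypothesis p_gt0 : (0 < p)%N.

(** Says that 1, w is a basis over the integers modulo p, independence and the bound on [#|A|]
    together giving generation. Natural coefficients spare [A] any algebra structure. The pair [a0],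
    [b0] is 0, 0 for dual numbers and 1, 1 for the field of order 4. *)
Definition quadratic_generator (A : finComNzRingType) (w : A) : Prop :=
  [/\ p%:R = 0 :> A, w * w = a0%:R + b0%:R * w, (#|A| <= p ^ 2)%N &
    forall a b : nat, a%:R + b%:R * w = 0 -> (p %| a)%N /\ (p %| b)%N].

Section Coordinates.
Variables (A : finComNzRingType) (w : A).
Hypothesis wP : quadratic_generator w.

Definition quad_elt (ab : 'I_p * 'I_p) : A := ab.1%:R + ab.2%:R * w.

Lemma quad_elt_bij : bijective quad_elt.
Proof.
have [p0 _ leA inj0] := wP.
apply: inj_card_bij; last by rewrite card_prod card_ord mulnn.
(* The difference of coordinates is written [i + (p - j)] to stay in [nat]; it lies strictly between
   0 and 2p, so divisibility by p forces it to be p. *)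
have modp_eq (i j : 'I_p) : (p %| i + (p - j))%N -> i = j.
  have := ltn_ord i; have := ltn_ord j => ltj lti /dvdnP[k]; move=> eqk;
    apply: val_inj => /=.
  have : (k * p < 2 * p)%N by lia.
  have : (0 < k * p)%N by lia.
  rewrite muln_gt0 ltn_mul2r => /andP[k0 _] /andP[_ k2].
  by rewrite (_ : k = 1%N) in eqk; lia.
have natrBp (i j : 'I_p) : (i + (p - j))%:R = i%:R - j%:R :> A.
  by rewrite natrD natrB ?p0 ?sub0r // ltnW.
move=> [i j] [i' j']; rewrite /quad_elt /= => eq_ij.
have [] := inj0 (i + (p - i'))%N (j + (p - j'))%N; last by move=> /modp_eq-> /modp_eq->.
by rewrite !natrBp mulrBl addrACA -opprD eq_ij subrr.
Qed.

Lemma natr_mod k : (k %% p)%:R = k%:R :> A.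
Proof. by have [p0 _ _ _] := wP;
  rewrite [in RHS](divn_eq k p) natrD natrM p0 mulr0 add0r. Qed.

Lemma quad_eltE (a b : nat) : a%:R + b%:R * w =
  quad_elt (Ordinal (ltn_pmod a p_gt0), Ordinal (ltn_pmod b p_gt0)).
Proof. by rewrite /quad_elt /= !natr_mod. Qed.

End Coordinates.

(** Copying coordinates is multiplicative because the same [a0] and [b0] reduce the square of either
    generator. *)
Lemma quadratic_generator_ring_isomorphic (A B : finComNzRingType) (w : A) (v : B) :
  quadratic_generator w -> quadratic_generator v -> ring_isomorphic A B.
Proof.
move=> wP vP; have [g gK Kg] := quad_elt_bij wP; have [h hK Kh] := quad_elt_bij vP.
pose f x := quad_elt v (g x).
have fE (a b : nat) : f (a%:R + b%:R * w) = a%:R + b%:R * v.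
  by rewrite (quad_eltE wP) (quad_eltE vP) /f gK.
have coord x : exists a b : nat, x = a%:R + b%:R * w.
  by rewrite -[x]Kg; exists (g x).1, (g x).2.
have fD x y : f (x + y) = f x + f y.
  have [a [b ->]] := coord x; have [c [d ->]] := coord y.
  by rewrite addrACA -mulrDl -!natrD !fE !natrD mulrDl addrACA.
have mulE (C : finComNzRingType) (u : C) (a b c d : nat) : quadratic_generator u ->
    (a%:R + b%:R * u) * (c%:R + d%:R * u)
    = (a * c + b * d * a0)%:R + (a * d + b * c + b * d * b0)%:R * u.
  case=> _ uu _ _; pose s := a%:R * d%:R + b%:R * c%:R : C.
  transitivity (a%:R * c%:R + s * u + b%:R * d%:R * (u * u)); first by rewrite /s; ring.
  by rewrite uu /s; ring.
apply: (@ring_isomorphicI _ _ f); last first.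
- exists (quad_elt w \o h) => x; rewrite /f /= ?hK ?Kg //.
  by rewrite gK Kh.
- split=> [|x y]; first by have := fE 1%N 0%N; rewrite !mul0r !addr0.
  have [a [b ->]] := coord x; have [c [d ->]] := coord y.
  by rewrite mulE // !fE mulE.
by move=> x y; apply/eqP; rewrite eq_sym subr_eq -fD subrK.
Qed.

End QuadraticExtension.

(** * Rings whose zero-divisors form an additive group of prime order *)

Section LocalPrime.
Variables (R : finComNzRingType) (p : nat).
Hypothesis p_pr : prime p.
Hypothesis card_Z : #|zdivs R| = p.
Hypothesis zdD : forall x y : R, zero_divisor x -> zero_divisor y -> zero_divisor (x + y).
Implicit Types x y : R.

Lemma zdivs_group_set : group_set (zdivs R).
Proof.
apply/group_setP; split=> [|x y]; rewrite !inE; first exact: zero_divisor0.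
exact: zdD.
Qed.

(** [ann x] is a subgroup of [zdivs R], of prime order, and contains a nonzero element. *)
Lemma ann_zero_divisor x : x != 0 -> zero_divisor x -> ann x = zdivs R.
Proof.
move=> x0 /zero_divisorP[y y0 xy0].
have sub := ann_subset_zdivs x0; apply/eqP; rewrite eqEcard sub /= card_Z.
have := card_ann_dvdn zdivs_group_set sub; rewrite card_Z.
case/primeP: p_pr => _ /[apply] /orP[]/eqP annx; rewrite annx //.
have : (#|[set 0%R; y]| <= #|ann x|)%N.
  by apply: subset_leq_card; apply/subsetP => z; rewrite !inE => /orP[]/eqP->;
    rewrite ?mulr0 ?xy0.
by rewrite annx cards2 eq_sym y0.
Qed.

Lemma zero_divisors_mul0 x y : zero_divisor x -> zero_divisor y -> x * y = 0.
Proof.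
move=> xz yz; have [->|x0] := eqVneq x 0; first by rewrite mul0r.
have: y \in ann x by rewrite ann_zero_divisor ?inE.
by rewrite inE => /eqP.
Qed.

Lemma zero_divisor_neq0 : exists2 x : R, x != 0 & zero_divisor x.
Proof.
have /card_gt1P[x [y []]] : (1 < #|zdivs R|)%N by rewrite card_Z prime_gt1.
rewrite !inE => xz yz neq_xy; have [x0|] := eqVneq x 0; last by exists x.
by exists y; rewrite // eq_sym -x0.
Qed.

(** For a nonzero zero-divisor [x], both the kernel and the image of multiplication by [x] lie in
    [zdivs R]. *)
Lemma local_prime_card : (#|R| <= p ^ 2)%N.
Proof.
have [x x0 xz] := zero_divisor_neq0.
rewrite -(card_ann x) ann_zero_divisor // card_Z -mulnn leq_mul2l -card_Z.
rewrite subset_leq_card ?orbT //; apply/subsetP => _ /imsetP[y _ ->].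
by rewrite inE zero_divisorMr.
Qed.

Lemma zero_divisor_prime : zero_divisor (p%:R : R).
Proof.
have [x x0 xz] := zero_divisor_neq0; apply/zero_divisorP; exists x => //.
by rewrite mulr_natl -card_Z natr_card ?inE //; apply: zdivs_group_set.
Qed.

(** If k were prime to p, a Bezout relation would write 1 as a sum of two zero-divisors. *)
Lemma zero_divisor_natr k : zero_divisor (k%:R : R) = (p %| k)%N.
Proof.
apply/idP/idP=> [kz | /dvdnP[m ->]]; last first.
  by rewrite natrM zero_divisorMl // zero_divisor_prime.
apply: contraT; rewrite -prime_coprime // coprime_sym => /eqP cop.
have k_gt0 : (0 < k)%N by case: (k) cop p_pr => // /[!gcd0n] ->.
have [u v defuv _] := egcdnP p k_gt0; rewrite cop in defuv.
suff: zero_divisor (1 : R) by rewrite zero_divisor1.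
have -> : 1 = (u * k)%:R + (v * p)%:R * -1 :> R by rewrite defuv natrD; ring.
by rewrite zdD // ?zero_divisorMr // natrM zero_divisorMl // zero_divisor_prime.
Qed.

(** If [k%:R = 0] then k = m p; as [p%:R] is nonzero and killed by m, p divides m as well. *)
Lemma local_prime_Zp2 : p%:R != 0 :> R -> ring_isomorphic R 'Z_(p ^ 2).
Proof.
move=> p0; have p1 := prime_gt1 p_pr; apply: ring_isomorphic_Zn => [||k].
- by rewrite -mulnn; nia.
- exact: local_prime_card.
apply/idP/idP => [/eqP k0 | /dvdnP[m ->]]; last first.
  rewrite natrM -mulnn natrM (@zero_divisors_mul0 p%:R) ?zero_divisor_prime //.
  by rewrite mulr0.
have: (p %| k)%N by rewrite -zero_divisor_natr k0 zero_divisor0.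
case/dvdnP=> m defk; rewrite defk -mulnn dvdn_pmul2r ?prime_gt0 //.
rewrite -zero_divisor_natr; apply/zero_divisorP; exists p%:R => //.
by rewrite -natrM -defk.
Qed.

(** Any nonzero zero-divisor serves as [w]. Multiplying a + b w = 0 by [w] gives a w = 0, so p
    divides a; then b w = 0, so p divides b. *)
Lemma local_prime_generator : p%:R = 0 :> R ->
  exists w : R, quadratic_generator p 0 0 w.
Proof.
move=> p0; have [w w0 wz] := zero_divisor_neq0; exists w; split=> //.
- by rewrite mul0r addr0; apply: zero_divisors_mul0.
- exact: local_prime_card.
move=> a b abw0; have aw0 : a%:R * w = 0.
  by rewrite -[RHS](mul0r w) -abw0 mulrDl -mulrA (zero_divisors_mul0 wz wz) mulr0 addr0.
have pa : (p %| a)%N by rewrite -zero_divisor_natr; apply/zero_divisorP; exists w.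
split=> //; rewrite -zero_divisor_natr; apply/zero_divisorP; exists w => //.
by case/dvdnP: pa abw0 => m ->; rewrite natrM p0 mulr0 add0r.
Qed.

End LocalPrime.

(** Joins the ring and finite structures on the carrier of the quotient, so an isomorphism onto it
    is one onto [dual_numbers A]. *)
Definition fin_dual (A : finComNzRingType) : finComNzRingType :=
  HB.pack_for finComNzRingType (dual_numbers A)
    (GRing.ComNzRing.class (dual_numbers A)) (Finite.class (dual_numbers A)).

Lemma dual_numbers_generator (p : nat) : (1 < p)%N ->
  quadratic_generator p 0 0 ('qX : fin_dual 'Z_p).
Proof.
move=> p1; have mkX2 := mk_monic_X2 'Z_p.
pose phi : {rmorphism {poly 'Z_p} -> dual_numbers 'Z_p} := in_qpoly ('X^2 : {poly 'Z_p}).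
have phiE (a b : nat) : (a%:R + b%:R * 'qX : dual_numbers 'Z_p) = phi (a%:R%:P +
  b%:R%:P * 'X).
  by rewrite !polyC_natr rmorphD rmorphM !rmorph_nat.
split.
- rewrite -[LHS](addr0) -[0 in X in X = _](mul0r 'qX); apply: etrans (phiE p 0%N) _.
  by rewrite pchar_Zp // mul0r addr0 rmorph0.
- rewrite mul0r addr0; change (('qX : dual_numbers 'Z_p) * 'qX = 0).
  rewrite -[_ * _](rmorphM phi) -expr2; apply: val_inj; rewrite /= mkX2.
  by rewrite Pdiv.RingMonic.rmodpp ?monicXn.
- change (#|dual_numbers 'Z_p| <= p ^ 2)%N;
    rewrite card_monic_qpoly ?monicXn ?size_polyXn //=.
  by rewrite card_ord Zp_cast.
move=> a b; rewrite phiE => /(congr1 val) /=.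
(* A polynomial of degree at most 1 is its own remainder modulo X^2, so its two coefficients can be
   read off. *)
rewrite mkX2 Pdiv.Ring.rmodp_small ?size_polyXn; last first.
  rewrite (leq_ltn_trans (size_polyD _ _)) // gtn_max.
  rewrite (leq_ltn_trans (size_polyC_leq1 _)) //=.
  by rewrite mul_polyC (leq_ltn_trans (size_scale_leq _ _)) // size_polyX.
move=> /polyP q0; have := q0 0%N; have := q0 1%N.
rewrite !coefE /= mulr0 mulr1 add0r addr0 => b0 a0.
have dvd k : (k%:R : 'Z_p) = 0 -> (p %| k)%N.
  by move/(congr1 val); rewrite /= val_Zp_nat // => /eqP.
by split; apply: dvd.
Qed.

(** * Products of two rings *)

Section PrimeOrder.
Variables (A : finComNzRingType) (p : nat).
Hypotheses (p_pr : prime p) (cardA : #|A| = p).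

Lemma ring_isomorphic_Zp : ring_isomorphic A 'Z_p.
Proof.
have p0 : p%:R = 0 :> A by rewrite -cardA natr_cardT.
apply: ring_isomorphic_Zn => [||k]; rewrite ?prime_gt1 ?cardA //.
apply/eqP/idP=> [k0 | /dvdnP[m ->]]; last by rewrite natrM p0 mulr0.
apply: contraT; rewrite -prime_coprime // coprime_sym => /eqP cop.
have k_gt0 : (0 < k)%N by case: (k) cop p_pr => // /[!gcd0n] ->.
have [u v defuv _] := egcdnP p k_gt0; rewrite cop in defuv.
have /eqP := congr1 (fun n => n%:R : A) defuv.
by rewrite natrD !natrM k0 p0 !mulr0 add0r eq_sym oner_eq0.
Qed.

End PrimeOrder.

(** For finite rings this means being a field; as a test it applies to factors that come without a
    field structure. *)
Definition zd_free (A : finComNzRingType) : bool := zdivs A == [set 0].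

Lemma zd_freeP (A : finComNzRingType) :
  reflect (forall x : A, zero_divisor x -> x = 0) (zd_free A).
Proof.
apply: (iffP eqP) => [zA x xz | zA].
  by apply/set1P; rewrite -zA inE.
apply/setP => x; rewrite !inE; apply/idP/eqP => [/zA//|->]; exact: zero_divisor0.
Qed.

Lemma zd_free_mul (A : finComNzRingType) (x y : A) : zd_free A ->
  (x * y == 0) = (x == 0) || (y == 0).
Proof.
move/zd_freeP=> zA; apply/eqP/orP => [xy0 | [/eqP x0|/eqP y0]]; last 2 first.
- by rewrite x0 mul0r.
- by rewrite y0 mulr0.
have [_|y0] := eqVneq y 0; first by right.
by left; apply/eqP/zA/zero_divisorP; exists y.
Qed.

Lemma zd_free_field (F : finFieldType) : zd_free F.
Proof.
apply/zd_freeP => x /zero_divisorP[y y0 /eqP].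
by rewrite mulf_eq0 (negPf y0) orbF => /eqP.
Qed.

Lemma zd_free_Zp p : prime p -> zd_free 'Z_p.
Proof.
move=> p_pr; apply/zd_freeP/card_prime_domain.
by rewrite card_ord Zp_cast ?prime_gt1.
Qed.

(** Since 2 * 2 = 0, the characteristic is 2, and for any [w] other than 0, 1 the elements are 0, 1,
    w, 1 + w. The product w (1 + w) is not 0; the values w and 1 + w would give w^2 = 0 and (w -
    1)(1 + w) = 0. So it is 1, that is, w^2 = 1 + w. *)
Lemma zd_free_card4_generator (A : finComNzRingType) : zd_free A -> #|A| = 4%N ->
  exists w : A, quadratic_generator 2 1 1 w.
Proof.
move=> domA cardA.
have two0 : 2%:R = 0 :> A.
  apply/eqP; have: (2%:R * 2%:R : A) == 0
    by rewrite -natrM (_ : (2 * 2)%N = #|A|) ?natr_cardT ?cardA.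
  by rewrite zd_free_mul // orbb.
have oppE (x : A) : - x = x by apply/eqP;
  rewrite eq_sym -addr_eq0 -mulr2n -mulr_natl two0 mul0r.
have [w] : exists w : A, w \notin [set 0; 1].
  apply/existsP; rewrite -negb_forall; apply/forallP=> all01.
  have /subset_leq_card : [set: A] \subset [set 0; 1].
    by apply/subsetP => x _; apply: all01.
  by rewrite cardsT cardA cards2; case: (_ != _).
rewrite !inE negb_or => /andP[w0 w1].
have w1_neq0 : 1 + w != 0 by rewrite addrC addr_eq0 oppE.
have natr_odd k : k%:R = (odd k)%:R :> A.
  by rewrite -[k in LHS]odd_double_half natrD -muln2 natrM two0 mulr0 addr0.
have inj0 (a b : nat) : a%:R + b%:R * w = 0 -> (2 %| a)%N /\ (2 %| b)%N.
  rewrite (natr_odd a) (natr_odd b) !dvdn2; case: (odd a); case: (odd b) => //=;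
    rewrite ?mul1r ?mul0r ?addr0 ?add0r => /eqP;
      rewrite ?oner_eq0 ?(negPf w0) ?(negPf w1_neq0) //.
exists w; split; rewrite ?cardA // !mul1r.
suff : w * (1 + w) = 1.
  by rewrite mulrDr mulr1 => /(canRL (addKr w)) ->; rewrite oppE addrC.
have: w * (1 + w) \in [set 0; 1; w; 1 + w].
  suff -> : [set 0; 1; w; 1 + w] = [set: A] by rewrite inE.
  apply/eqP; rewrite eqEcard subsetT cardsT cardA.
  have -> : #|[set 0; 1; w; 1 + w]| = size [:: 0; 1; w; 1 + w].
    rewrite -(card_uniqP _); first by apply: eq_card => x; rewrite !inE -!orbA.
    rewrite /= !inE !negb_or ![0 == _]eq_sym w0 w1_neq0 oner_neq0 eq_sym w1.
    rewrite eq_sym -subr_eq0 addrAC subrr add0r w0 eq_sym -subr_eq0 addrK oner_neq0.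
    by [].
  by [].
rewrite !inE zd_free_mul // (negPf w0) (negPf w1_neq0) /=.
case/orP=> [/orP[/eqP//|]|].
  rewrite -subr_eq0 (_ : _ - w = w * w); last by ring.
  by rewrite zd_free_mul // (negPf w0).
rewrite -subr_eq0 (_ : _ - _ = (w - 1) * (1 + w)); last by ring.
by rewrite zd_free_mul // subr_eq0 (negPf w1) (negPf w1_neq0).
Qed.

Definition fin_prod (A B : finComNzRingType) : finComNzRingType :=
  HB.pack_for finComNzRingType (A * B)%type
    (GRing.ComNzRing.class (A * B)%type) (Finite.class (A * B)%type).

Section Product.
Variables A B : finComNzRingType.

Lemma zero_divisor_prod (x : A) (y : B) :
  zero_divisor ((x, y) : fin_prod A B) = zero_divisor x || zero_divisor y.
Proof.
apply/zero_divisorP/orP => [[[u v]] | [] /zero_divisorP[z z0 xz0]].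
- rewrite xpair_eqE negb_and => /orP[u0|v0] [xu0 yv0].
    by left; apply/zero_divisorP; exists u.
  by right; apply/zero_divisorP; exists v.
- exists ((z, 0) : fin_prod A B); first by rewrite xpair_eqE (negPf z0).
  by congr (_, _); rewrite // mulr0.
exists ((0, z) : fin_prod A B); first by rewrite xpair_eqE (negPf z0) andbF.
by congr (_, _); rewrite // mulr0.
Qed.

Lemma card_fin_prod : #|fin_prod A B| = (#|A| * #|B|)%N.
Proof. exact: card_prod. Qed.

(** The complement is counted: a pair is regular exactly when both components are. *)
Lemma card_zdivs_prod : (#|zdivs (fin_prod A B)|
  + (#|A| - #|zdivs A|) * (#|B| - #|zdivs B|) = #|A| * #|B|)%N.
Proof.
have cardC (C : finComNzRingType) : #|~: zdivs C| = (#|C| - #|zdivs C|)%N.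
  by rewrite -(cardsC (zdivs C)) addKn.
rewrite -!cardC -cardsX -card_fin_prod -[RHS](cardsC (zdivs (fin_prod A B))).
congr (_ + #|pred_of_set _|)%N; apply/setP => -[x y].
by rewrite in_setX !inE zero_divisor_prod negb_or.
Qed.

End Product.

Lemma exists_neq0_coloring (A : finComNzRingType) k : (k.+1 < #|A|)%N ->
  exists f : A -> 'I_k.+1, forall i, exists2 x, x != 0 & f x = i.
Proof.
move=> ltkA; pose s := enum (predC1 (0 : A)).
(* Nonzero elements are coloured by their position; [inord] sends positions beyond k to colour 0,
   which does no harm as only surjectivity is wanted. *)
exists (fun x => inord (index x s)) => i.
have lt_is : (i < size s)%N.
  by rewrite -cardE cardC1 -subn1 ltn_subRL; apply: leq_ltn_trans (ltn_ord i) ltkA.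
exists (nth 0 s i); first by have := mem_nth 0 lt_is; rewrite mem_enum inE.
by rewrite index_uniq ?enum_uniq // inord_val.
Qed.

Lemma card2_neq0 (A : finComNzRingType) : #|A| = 2%N -> forall x : A, x != 0 -> x = 1.
Proof.
move=> cardA x x0; have: x \in [set 0; 1].
  suff -> : [set 0; 1] = [set: A] by rewrite inE.
  by apply/eqP; rewrite eqEcard subsetT cardsT cardA cards2 eq_sym oner_neq0.
by rewrite !inE (negPf x0) => /eqP.
Qed.

(** * Products of two fields, whose graphs are complete bipartite *)

Section FieldProduct.
Variables A B : finComNzRingType.
Hypotheses (domA : zd_free A) (domB : zd_free B).
Local Notation T := (fin_prod A B).
Local Notation G := (zero_divisor_graph T).

Lemma card_zdivs_field_prod : (#|zdivs T| + 1 = #|A| + #|B|)%N.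
Proof.
have := card_zdivs_prod A B; rewrite (eqP domA) (eqP domB) !cards1.
have a1 : (1 < #|A|)%N := card_finNzRing_gt1 A.
have b1 : (1 < #|B|)%N := card_finNzRing_gt1 B.
by nia.
Qed.

Lemma zero_divisor_field_prod (z : T) :
  zero_divisor z = (z.1 == 0) || (z.2 == 0).
Proof.
case: z => x y; rewrite zero_divisor_prod /=.
have zd0 (C : finComNzRingType) (c : C) : zd_free C -> zero_divisor c = (c == 0).
  by move/zd_freeP => zC; apply/idP/eqP => [/zC//|->]; apply: zero_divisor0.
by rewrite !zd0.
Qed.

Lemma field_prod_vertexl (x : A) : x != 0 -> exists v : G, val v = (x, 0).
Proof.
by move=> x0; apply: zdg_vertexP;
  rewrite ?zero_divisor_field_prod ?eqxx ?orbT // xpair_eqE (negPf x0).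
Qed.

Lemma field_prod_vertexr (y : B) : y != 0 -> exists v : G, val v = (0, y).
Proof.
by move=> y0; apply: zdg_vertexP;
  rewrite ?zero_divisor_field_prod ?eqxx // xpair_eqE (negPf y0) andbF.
Qed.

Lemma field_prod_vertexE (v : G) :
  (exists2 x, x != 0 & val v = (x, 0)) \/ (exists2 y, y != 0 & val v = (0, y)).
Proof.
have /andP[] := valP v; rewrite zero_divisor_field_prod; case: (val v) => x y /=.
rewrite xpair_eqE negb_and => nz /orP[]/eqP z0; rewrite z0 eqxx /= ?orbF in nz *.
  by right; exists y.
by left; exists x.
Qed.

Lemma field_prod_adj (v w : G) x y : val v = (x, 0) -> val w = (0, y) -> y != 0 ->
  adj v w && adj w v.
Proof.
move=> vx wy y0; rewrite [adj w v]adj_sym andbb /adj /= /zdg_adj.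
rewrite -(inj_eq val_inj) /= vx wy xpair_eqE [0 == y]eq_sym (negPf y0) andbF /=.
by apply/eqP; congr (_, _); rewrite /= ?mulr0 ?mul0r.
Qed.

Lemma zdeg_field_prodl x : x != 0 -> zdeg ((x, 0) : T) = #|B|.-1.
Proof.
move=> x0; rewrite /zdeg -(cardC1 (0 : B)) -(card_imset (predC1 0) (can_inj (g :=
  snd) (f := pair (0 : A)) _)) //.
apply: eq_card => -[u v]; rewrite inE; apply/and3P/imsetP => [[uv0 _] | [y]].
  case/eqP => /eqP; rewrite zd_free_mul // (negPf x0) /= => /eqP u0 _.
  by exists v; [move: uv0; rewrite u0 xpair_eqE eqxx inE | rewrite u0].
rewrite inE => y0 [-> ->]; rewrite !xpair_eqE (negPf y0) !andbF; split=> //.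
by rewrite /= mulr0 mul0r !eqxx.
Qed.

Lemma zdeg_field_prodr y : y != 0 -> zdeg ((0, y) : T) = #|A|.-1.
Proof.
move=> y0; rewrite /zdeg -(cardC1 (0 : A)) -(card_imset (predC1 0) (can_inj (g :=
  fst) (f := fun x => (x, 0 : B)) _)) //.
apply: eq_card => -[u v]; rewrite inE; apply/and3P/imsetP => [[uv0 _] | [x]].
  case/eqP => _ /eqP; rewrite zd_free_mul // (negPf y0) /= => /eqP v0.
  by exists u; [move: uv0; rewrite v0 xpair_eqE eqxx andbT inE | rewrite v0].
rewrite inE => x0 [-> ->]; rewrite !xpair_eqE (negPf x0) /=; split=> //.
by rewrite /= mulr0 mul0r !eqxx.
Qed.

(** Each side carries all k + 1 colours, so every vertex sees every colour, its own included; orders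
    at most 4 keep degrees at most 3. *)
Lemma leq_gda_partition_number_field_prod k :
    (k.+1 < #|A|)%N -> (k.+1 < #|B|)%N -> (#|A| <= 4)%N -> (#|B| <= 4)%N ->
  (k < gda_partition_number G)%N.
Proof.
move=> ltkA ltkB leA leB.
have [f fP] := exists_neq0_coloring ltkA; have [g gP] := exists_neq0_coloring ltkB.
pose c (v : G) := if (val v).2 == 0 then f (val v).1 else g (val v).2.
have nbh_color v i : exists2 w, adj v w & c w = i.
  case: (field_prod_vertexE v) => -[x x0 vx].
    have [y y0 gy] := gP i; have [w wy] := field_prod_vertexr y0; exists w.
      by case/andP: (field_prod_adj vx wy y0).
    by rewrite /c wy /= (negPf y0).
  have [y y0 fy] := fP i; have [w wy] := field_prod_vertexl y0; exists w.
    by case/andP: (field_prod_adj wy vx x0).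
  by rewrite /c wy /= eqxx.
apply: (@leq_gda_partition_number _ _ c) => [i|v i _|v] //.
  have [v _] := field_prod_vertexl (oner_neq0 A).
  by have [w _ cw] := nbh_color v i; exists w.
right; split; last exact: nbh_color.
rewrite card_nbh; case: (field_prod_vertexE v) => -[x x0 ->].
  by rewrite zdeg_field_prodl //; lia.
by rewrite zdeg_field_prodr //; lia.
Qed.

Lemma gda_partition_number_star_field_prod : #|A| = 2%N ->
  (1 < gda_number G)%N -> (gda_partition_number G <= 1)%N.
Proof.
move=> cardA g2; have [c cE] := field_prod_vertexl (oner_neq0 A).
apply: (gda_partition_number_star (x := c) g2) => v w /andP[_ /eqP vw0].
have A01 := card2_neq0 cardA.
rewrite -!(inj_eq val_inj) /= cE.
case: (field_prod_vertexE v) => -[x x0 vx]; first by rewrite vx (A01 _ x0) eqxx.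
case: (field_prod_vertexE w) => -[y y0 wy]; first by rewrite wy (A01 _ y0) eqxx orbT.
by move: vw0; rewrite vx wy => -[_ /eqP]; rewrite zd_free_mul // (negPf x0) (negPf y0).
Qed.

End FieldProduct.

(** * Square-zero elements *)

Section SquareZero.
Variables (R : finComNzRingType) (p : nat) (x : R).
Hypotheses (p_pr : prime p) (cardR : #|R| = (p ^ 2)%N) (x0 : x != 0) (xx0 : x * x = 0).

(** The ideal x R is nonzero and contained in [ann x], and the product of their orders is p^2, so
    both have order p. *)
Lemma card_ann_square_zero : #|ann x| = p /\ ann x = [set (x * r)%R | r in R].
Proof.
have sub : [set (x * r)%R | r in R] \subset ann x.
  by apply/subsetP => _ /imsetP[r _ ->]; rewrite inE mulrA xx0 mul0r.
have le := subset_leq_card sub.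
have gt1 : (1 < #|[set (x * r)%R | r in R]|)%N.
  apply/card_gt1P; exists 0, x; split; last by rewrite eq_sym.
    by apply/imsetP; exists 0; rewrite // mulr0.
  by apply/imsetP; exists 1; rewrite // mulr1.
have eq_pp := card_ann x; rewrite cardR in eq_pp.
have /(dvdn_pfactor _ _ p_pr)[k lek annk] : (#|ann x| %| p ^ 2)%N.
  by rewrite -eq_pp dvdn_mulr.
have p1 := prime_gt1 p_pr.
have annp : #|ann x| = p.
  case: k lek annk => [|[|[|//]]] _ annk; rewrite ?annk ?expn1 //.
    by rewrite annk in le; move: (leq_trans gt1 le).
  move: eq_pp; rewrite annk -[RHS]muln1 => /eqP.
  by rewrite eqn_pmul2l ?expn_gt0 ?prime_gt0 // => /eqP eq1; rewrite eq1 in gt1.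
split=> //; apply/eqP; rewrite eq_sym eqEcard sub annp /=.
by move: eq_pp; rewrite annp -mulnn => /eqP; rewrite eqn_pmul2l ?prime_gt0 // => /eqP->.
Qed.

(** If [x * y != 0], then x y R fills x R, of order p, so x = x y u for some u. Then y u - 1 lies in
    [ann x], so y u = 1 + x r, with inverse 1 - x r, and [y] is a unit. *)
Lemma zdivs_square_zero : zdivs R = ann x.
Proof.
have [annp annE] := card_ann_square_zero.
apply/eqP; rewrite eqEsubset ann_subset_zdivs // andbT; apply/subsetP => y.
rewrite inE => yz; apply: contraT => /[!inE] xy0.
have [u xyu] : exists u, x * (y * u) = x.
  have sub : [set (x * y * r)%R | r in R] \subset [set (x * r)%R | r in R].
    by apply/subsetP => _ /imsetP[r _ ->]; apply/imsetP; exists (y * r); rewrite // mulrA.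
  have gt1 : (1 < #|[set (x * y * r)%R | r in R]|)%N.
    apply/card_gt1P; exists 0, (x * y); split; last by rewrite eq_sym.
      by apply/imsetP; exists 0; rewrite // mulr0.
    by apply/imsetP; exists 1; rewrite // mulr1.
  have : x \in [set (x * y * r)%R | r in R].
    suff -> : [set (x * y * r)%R | r in R] = [set (x * r)%R | r in R].
      by apply/imsetP; exists 1; rewrite // mulr1.
    apply/eqP; rewrite eqEcard sub -annE annp.
    have: (#|[set (x * y * r)%R | r in R]| %| p ^ 2)%N.
      by rewrite -cardR -(card_ann (x * y)) dvdn_mull.
    case/(dvdn_pfactor _ _ p_pr) => k _ cardk; rewrite cardk in gt1 *.
    by case: k {cardk} gt1 => // k _; rewrite expnS leq_pmulr // expn_gt0 prime_gt0.
  by case/imsetP=> u _ xE; exists u; rewrite mulrA -xE.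
have: y * u - 1 \in ann x by rewrite inE mulrBr xyu mulr1 subrr.
rewrite annE => /imsetP[r _ yu1].
have: zero_divisor (y * (u * (1 - x * r))) by apply: zero_divisorMr.
have -> : y * (u * (1 - x * r)) = 1.
  rewrite mulrA (_ : y * u = 1 + x * r); last by rewrite -yu1 addrC subrK.
  by transitivity (1 - x * x * (r * r)); [ring | rewrite xx0 mul0r subr0].
by rewrite zero_divisor1.
Qed.

Lemma card_zdivs_square_zero : #|zdivs R| = p.
Proof. by rewrite zdivs_square_zero; case: card_ann_square_zero. Qed.

Lemma mul0_square_zero (y z : R) : zero_divisor y -> zero_divisor z -> y * z = 0.
Proof.
have [_ annE] := card_ann_square_zero.
have zdE t : zero_divisor t = (t \in [set (x * r)%R | r in R]).
  by rewrite -annE -zdivs_square_zero inE.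
rewrite !zdE => /imsetP[r _ ->] /imsetP[s _ ->].
by rewrite mulrACA xx0 mul0r.
Qed.

End SquareZero.

Lemma Zp2_square_zero p : prime p ->
  [/\ #|'Z_(p ^ 2)| = (p ^ 2)%N, p%:R != 0 :> 'Z_(p ^ 2)
    & p%:R * p%:R = 0 :> 'Z_(p ^ 2)].
Proof.
move=> p_pr; have p1 := prime_gt1 p_pr.
have p21 : (1 < p ^ 2)%N by rewrite -mulnn; nia.
split; first by rewrite card_ord Zp_cast.
  rewrite -(inj_eq val_inj) /= val_Zp_nat // modn_small; first by lia.
  by rewrite -mulnn; nia.
by rewrite -natrM mulnn pchar_Zp.
Qed.

Lemma dual_numbers_square_zero p : prime p -> 
  [/\ #|fin_dual 'Z_p| = (p ^ 2)%N, 'qX != 0 :> fin_dual 'Z_p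
    & 'qX * 'qX = 0 :> fin_dual 'Z_p].
Proof.
move=> p_pr; have gen := dual_numbers_generator (prime_gt1 p_pr).
have [p0 qq leq inj0] := gen; split; last by rewrite qq mul0r addr0.
  have := bij_eq_card (quad_elt_bij (prime_gt0 p_pr) gen).
  by rewrite card_prod card_ord mulnn => <-.
apply/eqP => q0; have [|_] := inj0 0%N 1%N; first by rewrite q0 mulr0 addr0.
rewrite dvdn1 => /eqP p1.
by rewrite p1 in p_pr.
Qed.

Lemma gda_partition_number_square_zero25 (R : finComNzRingType) (x : R) :
    #|R| = 25%N -> x != 0 -> x * x = 0 ->
  #|zdivs R| = 5%N /\ (2 <= gda_partition_number (zero_divisor_graph R))%N.
Proof.
move=> card25 x0 xx0; have Z5 := @card_zdivs_square_zero R 5 x isT card25 x0 xx0.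
split=> //; apply: gda_partition_number_K4.
  by move: Z5; rewrite card_zdivs => -[].
move=> v w neq_vw; rewrite /adj /= /zdg_adj neq_vw.
have /andP[_ vz] := valP v; have /andP[_ wz] := valP w.
by apply/eqP/(@mul0_square_zero R 5 x).
Qed.

(** * A ring of order 2 times a ring of order 4 with a square-zero element *)

Section Tree.
Variables (A B : finComNzRingType) (d : B).
Hypotheses (cardA : #|A| = 2%N) (cardB : #|B| = 4%N) (d0 : d != 0) (dd0 : d * d = 0).
Local Notation T := (fin_prod A B).
Local Notation G := (zero_divisor_graph T).

Let A01 : forall x : A, x != 0 -> x = 1 := card2_neq0 cardA.

Let domA : zd_free A.
Proof. by apply/zd_freeP/card_prime_domain; rewrite cardA. Qed.

Let zdB y : zero_divisor y = (y \in [set 0; d]).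
Proof.
have Z2 := @card_zdivs_square_zero B 2 d isT cardB d0 dd0.
suff -> : [set 0; d] = zdivs B by rewrite inE.
apply/eqP; rewrite eqEcard Z2 cards2 eq_sym d0 andbT; apply/subsetP => z.
rewrite !inE => /orP[]/eqP->; first exact: zero_divisor0.
by apply/zero_divisorP; exists d.
Qed.

Lemma card_zdivs_tree : #|zdivs T| = 6%N.
Proof.
have := card_zdivs_prod A B.
have Z2 := @card_zdivs_square_zero B 2 d isT cardB d0 dd0.
by rewrite (eqP domA) cards1 Z2 cardA cardB; lia.
Qed.

(** The graph is a tree: (1, 0) is joined to (0, d) and to two leaves (0, y), and (0, d) is joined
    to one more leaf (1, d). *)
Lemma leq2_gda_partition_number_tree : (2 <= gda_partition_number G)%N.
Proof.
have G5 : #|G| = 5%N by apply: succn_inj; rewrite -card_zdivs card_zdivs_tree.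
have zdz (z : T) : zero_divisor z = (z.1 == 0) || (z.2 \in [set 0; d]).
  case: z => x y; rewrite zero_divisor_prod zdB /=; congr (_ || _).
  by apply/idP/eqP => [/(zd_freeP A domA)//|->]; apply: zero_divisor0.
have vtx (x : A) (y : B) : (x, y) != 0 :> T -> (x == 0) || (y \in [set 0; d]) ->
    exists v : G, val v = (x, y).
  by move=> nz z; apply: zdg_vertexP; rewrite ?zdz.
have adjE (v w : G) x y x' y' : val v = (x, y) -> val w = (x', y') ->
    adj v w = ((x, y) != (x', y')) && ((x * x' == 0) && (y * y' == 0)).
  by move=> vE wE; rewrite /adj /= /zdg_adj -(inj_eq val_inj) /= vE wE.
have n10 : 1 != 0 :> A := oner_neq0 A.
have n10B : 1 != 0 :> B := oner_neq0 B.
have n1d : 1 != d.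
  by apply: contra_neq d0 => d1; rewrite -[LHS]mul1r d1.
have [v1 v1E] : exists v : G, val v = (1, 0) by apply: vtx;
  rewrite ?xpair_eqE ?(negPf n10) // !inE eqxx orbT.
have [v2 v2E] : exists v : G, val v = (0, d) by apply: vtx;
  rewrite ?xpair_eqE ?(negPf d0) ?andbF // eqxx.
have [v3 v3E] : exists v : G, val v = (0, 1) by apply: vtx;
  rewrite ?xpair_eqE ?(negPf n10B) ?andbF // eqxx.
have [v4 v4E] : exists v : G, val v = (1, d) by apply: vtx;
  rewrite ?xpair_eqE ?(negPf n10) // !inE eqxx !orbT.
have n01 : (0 == 1 :> A) = false by rewrite eq_sym (negPf n10).
have shape (v : G) : [\/ v = v1, v = v2, v = v4
    | exists y, [/\ val v = (0, y), y != 0 & y != d]].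
  have /andP[] := valP v; rewrite zdz; case vE: (val v) => [x y] /=.
  rewrite xpair_eqE negb_and; have [x0|x0] := eqVneq x 0 => /=.
    move=> y0 _; have [yd|yd] := eqVneq y d.
      by constructor 2; apply: val_inj; rewrite vE v2E x0 yd.
    by constructor 4; exists y; rewrite x0.
  move=> _; rewrite !inE => /orP[]/eqP y0.
    by constructor 1; apply: val_inj; rewrite vE v1E (A01 x0) y0.
  by constructor 3; apply: val_inj; rewrite vE v4E (A01 x0) y0.
(* The two inner vertices form one class and defend each other; the three leaves form the other,
   each having degree 1. *)
pose c (v : G) : 'I_2 := if v \in [set v1; v2] then ord0 else ord_max.
have v_neq (v w : G) : val v != val w -> (v == w) = false
  by rewrite (inj_eq val_inj) => /negPf.
have v41 : (v4 == v1) = false by apply: v_neq; rewrite v4E v1E xpair_eqE (negPf d0) andbF.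
have v42 : (v4 == v2) = false by apply: v_neq; rewrite v4E v2E xpair_eqE (negPf n10).
have v31 : (v3 == v1) = false by apply: v_neq; rewrite v3E v1E xpair_eqE n01.
have v32 : (v3 == v2) = false by apply: v_neq;
  rewrite v3E v2E xpair_eqE (negPf n1d) andbF.
have c1 : c v1 = ord0 by rewrite /c !inE eqxx.
have c2 : c v2 = ord0 by rewrite /c !inE eqxx orbT.
have c3 : c v3 = ord_max by rewrite /c !inE v31 v32.
have c4 : c v4 = ord_max by rewrite /c !inE v41 v42.
have c0y (v : G) (y : B) : val v = (0, y) -> y != d -> c v = ord_max.
  move=> vE yd; rewrite /c !inE !v_neq ?vE ?v1E ?v2E ?xpair_eqE ?n01 //.
  by rewrite (negPf yd) andbF.
have a12 : adj v1 v2 by rewrite (adjE _ _ _ _ _ _ v1E v2E) xpair_eqE (negPf n10)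
  mulr0 mul0r !eqxx.
have a13 : adj v1 v3 by rewrite (adjE _ _ _ _ _ _ v1E v3E) xpair_eqE (negPf n10)
  mulr0 mul0r !eqxx.
have a24 : adj v2 v4 by rewrite (adjE _ _ _ _ _ _ v2E v4E) xpair_eqE n01 dd0 mul0r !eqxx.
have a1y (v : G) (y : B) : val v = (0, y) -> adj v1 v.
  by move=> vE; rewrite (adjE _ _ _ _ _ _ v1E vE) xpair_eqE (negPf n10) mulr0 mul0r !eqxx.
have a14 : adj v1 v4 = false.
  by rewrite (adjE _ _ _ _ _ _ v1E v4E) mulr1 (negPf n10) andbF.
have ayz (v w : G) (x : A) (y z : B) : val v = (0, y) -> y != 0 -> y != d -> val w =
  (x, z) ->
    z != 0 -> adj v w = false.
  move=> vE y0 yd wE z0; rewrite (adjE _ _ _ _ _ _ vE wE);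
    apply/negP => /and3P[_ _ /eqP yz0].
  have: zero_divisor y by apply/zero_divisorP; exists z.
  by rewrite zdB !inE (negPf y0) (negPf yd).
have nbh2 : nbh v2 \subset [set v1; v4].
  apply/subsetP => w; rewrite !inE; case: (shape w) => [->|->|->|[y [wE y0 yd]]].
  - by rewrite eqxx.
  - by rewrite adj_irrefl.
  - by rewrite eqxx orbT.
  by rewrite adj_sym (ayz _ _ _ _ _ wE y0 yd v2E d0).
have nbh4 : nbh v4 \subset [set v2].
  apply/subsetP => w; rewrite !inE; case: (shape w) => [->|->|->|[y [wE y0 yd]]].
  - by rewrite adj_sym a14.
  - by rewrite eqxx.
  - by rewrite adj_irrefl.
  by rewrite adj_sym (ayz _ _ _ _ _ wE y0 yd v4E d0).
have nbh0y (v : G) (y : B) : val v = (0, y) -> y != 0 -> y != d -> nbh v \subset [set v1].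
  move=> vE y0 yd; apply/subsetP => w; rewrite !inE.
  case: (shape w) => [->|->|->|[z [wE z0 zd]]].
  - by rewrite eqxx.
  - by rewrite (ayz _ _ _ _ _ vE y0 yd v2E d0).
  - by rewrite (ayz _ _ _ _ _ vE y0 yd v4E d0).
  by rewrite (ayz _ _ _ _ _ vE y0 yd wE z0).
have ord2 (i : 'I_2) : (i != ord0 -> i = ord_max) /\ (i != ord_max -> i = ord0).
  by case: i => [[|[|//]]] ?; split=> //= _; apply: val_inj.
have le1 (v w : G) : nbh v \subset [set w] -> (#|nbh v| <= 1)%N.
  by move/subset_leq_card; rewrite cards1.
apply: (@leq_gda_partition_number _ _ c) => [i|v i|v].
- by have [->|/(ord2 i).1->] := eqVneq i ord0; [exists v1 | exists v3].
- case: (shape v) => [->|->|->|[y [vE y0 yd]]].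
  + by rewrite c1 => /(ord2 i).1->; exists v3.
  + by rewrite c2 => /(ord2 i).1->; exists v4.
  + by rewrite c4 => /(ord2 i).2->; exists v2; rewrite // adj_sym.
  by rewrite (c0y _ _ vE yd) => /(ord2 i).2->; exists v1; rewrite // adj_sym (a1y _ _ vE).
case: (shape v) => [->|->|->|[y [vE y0 yd]]].
- right; split; last by exists v2; rewrite ?c1 ?c2.
  have /subset_leq_card : nbh v1 \subset ~: [set v1; v4].
    apply/subsetP => w; rewrite !inE negb_or; apply: contraTT.
    by rewrite negb_and !negbK => /orP[]/eqP->; rewrite ?adj_irrefl ?a14.
  by rewrite [#|~: _|]cardsCs setCK G5 cards2 eq_sym v41.
- right; split; last by exists v1; rewrite ?c1 ?c2 // adj_sym.
  by rewrite (leq_trans (subset_leq_card nbh2)) // cards2; case: (_ != _).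
- by left; apply: le1 nbh4.
by left; apply: le1 (nbh0y _ _ vE y0 yd).
Qed.

End Tree.

(** * Partition numbers of the listed rings *)

Section PartitionNumbers.
Variable R : finComNzRingType.
Hypothesis g2 : gda_number (zero_divisor_graph R) = 2%N.

(** With 0 removed, at most 2k + 1 vertices remain, too few for k + 1 classes of at least two. *)
Lemma gda_partition_number_eq (T : finComNzRingType) k :
    ring_isomorphic R T -> (#|zdivs T| <= k.+1.*2)%N ->
    (k <= gda_partition_number (zero_divisor_graph T))%N ->
  gda_partition_number (zero_divisor_graph R) = k.
Proof.
move=> RT leTk lek; apply/eqP; rewrite eqn_leq.
rewrite {2}(ring_isomorphic_gda_partition_number RT) lek andbT.
apply: gda_partition_number_le; rewrite g2 mul2n.
by apply: leq_trans leTk; rewrite -(ring_isomorphic_zdivs RT) card_zdivs.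
Qed.

(** The constant 5: there are [#|A| + #|B| - 1] zero-divisors, to be at most 2(k + 2) for an upper
    bound of k + 1. *)
Lemma gda_partition_number_field_prod (A B : finComNzRingType) k :
    zd_free A -> zd_free B -> ring_isomorphic R (A * B)%type ->
    (k.+1 < #|A| <= 4)%N -> (k.+1 < #|B| <= 4)%N -> (#|A| + #|B| <= k.*2 + 5)%N ->
  gda_partition_number (zero_divisor_graph R) = k.+1.
Proof.
move=> domA domB RAB /andP[ltA leA] /andP[ltB leB] leAB.
apply: (@gda_partition_number_eq (fin_prod A B)) => //.
  have zAB := card_zdivs_field_prod domA domB.
  by move: leAB; rewrite -zAB addn1 !doubleS; lia.
exact: leq_gda_partition_number_field_prod.
Qed.

Lemma gda_partition_number_tree (A B : finComNzRingType) (d : B) :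
    #|A| = 2%N -> #|B| = 4%N -> d != 0 -> d * d = 0 ->
    ring_isomorphic R (A * B)%type ->
  gda_partition_number (zero_divisor_graph R) = 2%N.
Proof.
move=> cardA cardB d0 dd0 RAB; apply: (@gda_partition_number_eq (fin_prod A B)) => //.
  by rewrite (card_zdivs_tree cardA cardB d0 dd0).
exact: leq2_gda_partition_number_tree cardA cardB d0 dd0.
Qed.

Lemma gda_partition_number_square_zero (T : finComNzRingType) (x : T) :
    #|T| = 25%N -> x != 0 -> x * x = 0 -> ring_isomorphic R T ->
  gda_partition_number (zero_divisor_graph R) = 2%N.
Proof.
move=> card25 x0 xx0 RT.
have [Z5 le2] := gda_partition_number_square_zero25 card25 x0 xx0.
by apply: (gda_partition_number_eq RT); rewrite ?Z5.
Qed.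

(** Separates the one classified ring absent from the theorem; its graph is a star with three
    leaves. *)
Lemma gda_partition_number_Z2xGF4 : ring_isomorphic R ('Z_2 * GF4)%type ->
  (gda_partition_number (zero_divisor_graph R) <= 1)%N.
Proof.
move=> RT; pose T := fin_prod 'Z_2 GF4; have {}RT : ring_isomorphic R T := RT.
rewrite (ring_isomorphic_gda_partition_number RT).
apply: gda_partition_number_star_field_prod;
  rewrite ?card_ord ?zd_free_field ?zd_free_Zp //.
by rewrite (ring_isomorphic_gda_number RT) ?g2.
Qed.

Definition two_part_rings : Prop :=
  ring_isomorphic R ('Z_2 * 'Z_4)%type \/
  ring_isomorphic R ('Z_2 * dual_numbers 'Z_2)%type \/
  ring_isomorphic R ('Z_3 * 'Z_3)%type \/
  ring_isomorphic R ('Z_3 * GF4)%type \/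
  ring_isomorphic R 'Z_25 \/
  ring_isomorphic R (dual_numbers 'Z_5).

Lemma two_part_rings_gda_partition_number : two_part_rings ->
  gda_partition_number (zero_divisor_graph R) = 2%N.
Proof.
have [c4 d0 dd0] := @Zp2_square_zero 2 isT.
have [c4' q0 qq0] := @dual_numbers_square_zero 2 isT.
have [c25 e0 ee0] := @Zp2_square_zero 5 isT.
have [c25' r0 rr0] := @dual_numbers_square_zero 5 isT.
case=> [|[|[|[|[|]]]]] RT.
- by apply: (gda_partition_number_tree _ c4 d0 dd0 RT); rewrite card_ord.
- by apply: (gda_partition_number_tree _ c4' q0 qq0 RT); rewrite card_ord.
- by apply: (gda_partition_number_field_prod _ _ RT); rewrite ?zd_free_Zp ?card_ord.
- by apply: (gda_partition_number_field_prod _ _ RT);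
    rewrite ?zd_free_Zp ?zd_free_field ?card_ord ?card_GF4.
- exact: (gda_partition_number_square_zero c25 e0 ee0 RT).
- exact: (gda_partition_number_square_zero c25' r0 rr0 RT).
Qed.

Lemma GF4xGF4_gda_partition_number : ring_isomorphic R (GF4 * GF4)%type ->
  gda_partition_number (zero_divisor_graph R) = 3%N.
Proof.
move=> RT; apply: (gda_partition_number_field_prod _ _ RT);
  by rewrite ?zd_free_field ?card_GF4.
Qed.

End PartitionNumbers.

Lemma ring_isomorphic_GF4 (A : finComNzRingType) :
  zd_free A -> #|A| = 4%N -> ring_isomorphic A GF4.
Proof.
move=> domA cardA; have [w wP] := zd_free_card4_generator domA cardA.
have [v vP] := zd_free_card4_generator (zd_free_field GF4) card_GF4.
exact: (quadratic_generator_ring_isomorphic (ltn0Sn 1) wP vP).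
Qed.

(** The two cases are the two possible characteristics, p^2 and p. Applied with p = 5 to the whole
    ring and with p = 2 to a factor. *)
Lemma local_prime_classification (R : finComNzRingType) p : prime p ->
    #|zdivs R| = p ->
    (forall x y : R, zero_divisor x -> zero_divisor y -> zero_divisor (x + y)) ->
  ring_isomorphic R 'Z_(p ^ 2) \/ ring_isomorphic R (dual_numbers 'Z_p).
Proof.
move=> p_pr Zp zdD; have [p0|p0] := eqVneq (p%:R : R) 0; last first.
  by left; apply: local_prime_Zp2.
right; have [w wP] := local_prime_generator p_pr Zp zdD p0.
have vP := dual_numbers_generator (prime_gt1 p_pr).
exact: (quadratic_generator_ring_isomorphic (prime_gt0 p_pr) wP vP).
Qed.

Section Classification.
Variable R : finComNzRingType.
Hypothesis g2 : gda_number (zero_divisor_graph R) = 2%N.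
Hypothesis Z_gt4 : (4 < #|zdivs R|)%N.

Let Z_le7 : (#|zdivs R| <= 7)%N.
Proof. by rewrite card_zdivs ltnS gda_number2_card. Qed.

Lemma classify_local :
    (forall e : R, e * e = e -> e = 0 \/ e = 1) ->
  ring_isomorphic R 'Z_25 \/ ring_isomorphic R (dual_numbers 'Z_5).
Proof.
move=> idem; have zdD := zero_divisorD idem.
have : #|zdivs R| \in [:: 5; 6; 7]%N by move: Z_gt4 Z_le7; rewrite !inE; lia.
rewrite !inE => /or3P[]/eqP cardZ; first exact: (@local_prime_classification R 5).
  (* Cauchy: a zero-divisor of additive order q is killed by [q%:R]. *)
  have zd_natr q : prime q -> (q %| 6)%N -> zero_divisor (q%:R : R).
    move=> q_pr qZ; rewrite -cardZ in qZ.
    have [x xZ ordx] := Cauchy (G := Group (zdivs_group_set zdD)) q_pr qZ.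
    apply/zero_divisorP; exists x; last by rewrite mulr_natl -zmodXgE -ordx expg_order.
    by apply: contraTneq q_pr => x0; rewrite -ordx x0 order1.
  have: zero_divisor (3%:R + 2%:R * -1 : R).
    by apply: zdD; [|apply: zero_divisorMr]; apply: zd_natr.
  by rewrite (_ : _ + _ = 1) ?zero_divisor1 //; ring.
(* With seven zero-divisors all of them kill [x], giving it degree 5 against the bound 3. *)
have [|x [y [x0 y0 xy0 _ /andP[degx _]]]] := gda_number2_zero_divisors g2.
  by rewrite cardZ.
have xz : zero_divisor x by apply/zero_divisorP; exists y.
have annx := ann_zero_divisor (isT : prime 7) cardZ zdD x0 xz.
have : (#|zdivs R| <= 2 + zdeg x)%N.
  have /subset_leq_card : zdivs R \subset
      [set 0; x] :|: [set z | [&& z != 0, z != x & x * z == 0]].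
    apply/subsetP => z zZ; rewrite !inE.
    have -> : x * z == 0 by rewrite -annx inE in zZ.
    by case: (z == 0); case: (z == x).
  move/leq_trans; apply; rewrite (leq_trans (leq_card_setU _ _)) // leq_add2r cards2.
  by case: (_ != _).
by rewrite cardZ => le7; have := leq_trans le7 (leq_add (leqnn 2) degx).
Qed.

End Classification.

(** * Classification *)

Section FieldFactors.
Variables A B : finComNzRingType.
Hypotheses (domA : zd_free A) (domB : zd_free B).
Local Notation T := (fin_prod A B).
Hypothesis g2 : gda_number (zero_divisor_graph T) = 2%N.

(** At most five zero-divisors mean [#|A| + #|B| <= 6] with both at least 2. Otherwise the
    dominating pair is adjacent, hence on opposite sides, and its degrees [#|B| - 1] and [#|A| - 1]
    are at most 3. *)
Lemma field_factors_leq4 : (#|A| <= 4)%N && (#|B| <= 4)%N.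
Proof.
have cardZ := card_zdivs_field_prod domA domB.
have A1 : (1 < #|A|)%N := card_finNzRing_gt1 A.
have B1 : (1 < #|B|)%N := card_finNzRing_gt1 B.
have [le5|gt5] := leqP #|zdivs T| 5; first by apply/andP; split; lia.
have le4 : (#|A|.-1 <= 3)%N && (#|B|.-1 <= 3)%N -> (#|A| <= 4)%N && (#|B| <= 4)%N.
  by move=> /andP[leA leB]; apply/andP; split; lia.
have [[x1 x2] [[y1 y2] [x0 y0 xy0 _ degs]]] := gda_number2_zero_divisors g2 gt5.
have [/eqP xy1 /eqP xy2] : x1 * y1 = 0 /\ x2 * y2 = 0 by case: xy0.
move: x0 y0 xy1 xy2 degs; rewrite !zd_free_mul // => x0 y0.
have nz (x : A) (y : B) : (x, y) != 0 :> T -> (x == 0) && (y == 0) = false.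
  by move/negPf; rewrite xpair_eqE.
move/nz: x0 => x0; move/nz: y0 => y0.
have [x10|x10] := boolP (x1 == 0); have [x20|x20] := boolP (x2 == 0);
  have [y10|y10] := boolP (y1 == 0); have [y20|y20] := boolP (y2 == 0) => //= _ _;
  move: x0 y0; rewrite ?x10 ?x20 ?y10 ?y20 ?(negPf x10) ?(negPf x20) ?(negPf y10)
    ?(negPf y20) //= => _ _.
  by rewrite (eqP x10) (eqP y20) zdeg_field_prodl // zdeg_field_prodr // => /le4.
by rewrite (eqP x20) (eqP y10) zdeg_field_prodl // zdeg_field_prodr // andbC => /le4.
Qed.

End FieldFactors.

Section NonFieldFactor.
Variables A B : finComNzRingType.
Hypothesis nfB : ~~ zd_free B.
Local Notation T := (fin_prod A B).
Hypothesis g2 : gda_number (zero_divisor_graph T) = 2%N.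

Lemma nonfield_factor_card : [/\ #|A| = 2, #|B| = 4 & #|zdivs B| = 2]%N.
Proof.
have A1 : (1 < #|A|)%N := card_finNzRing_gt1 A.
have B1 : (1 < #|B|)%N := card_finNzRing_gt1 B.
have B_npr : ~~ prime #|B| by apply: contra nfB => prB; apply/zd_freeP/card_prime_domain.
have Z_le7 : (#|zdivs T| <= 7)%N by rewrite card_zdivs ltnS gda_number2_card.
have ZA1 : (0 < #|zdivs A|)%N by rewrite card_zdivs.
have ZB2 : (1 < #|zdivs B|)%N.
  rewrite card_zdivs ltnS lt0n; apply: contra nfB => /eqP G0.
  rewrite /zd_free eq_sym eqEcard cards1 card_zdivs G0 andbT.
  by apply/subsetP => x /set1P->; rewrite inE zero_divisor0.
have ltZ (C : finComNzRingType) : (#|zdivs C| < #|C|)%N.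
  rewrite -[#|C|]cardsT proper_card // properT; apply/eqP => ZC.
  by have := in_setT (1 : C); rewrite -ZC inE zero_divisor1.
have ltA := ltZ A; have ltB := ltZ B; have cardT := card_zdivs_prod A B.
(* With a, b the two orders, there are at least ab - (a - 1)(b - 2) = 2a + b - 2 zero-divisors. At
   most 7 of them with a >= 2 forces b <= 5; b is not prime, so b = 4, and then a = 2. *)
have [cardA cardB] : #|A| = 2%N /\ #|B| = 4%N.
  have : (#|B| != 2)%N by apply: contra B_npr => /eqP->.
  have : (#|B| != 3)%N by apply: contra B_npr => /eqP->.
  have : (#|B| != 5)%N by apply: contra B_npr => /eqP->.
  have : ((#|A| - #|zdivs A|) * (#|B| - #|zdivs B|) <= (#|A| - 1) * (#|B| - 2))%N.
    by apply: leq_mul; lia.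
  move: #|A| #|B| #|zdivs T| (_ * _)%N A1 B1 Z_le7 cardT =>
    a b z s a1 b1 z7 zs sle b5 b3 b2.
  by split; nia.
split=> //.
have ZA : #|zdivs A| = 1%N by rewrite (eqP (_ : zd_free A)) ?cards1 //;
  apply/zd_freeP/card_prime_domain; rewrite cardA.
move: cardT ltB; rewrite ZA cardA cardB => cardT ltB.
(* Three zero-divisors in [B] would leave 1 as its only regular element and give the product seven
   zero-divisors; this is the case of Z_2 x Z_2 x Z_2. *)
have [//|ZB3] : #|zdivs B| = 2%N \/ #|zdivs B| = 3%N by lia.
have [|[x1 x2] [[y1 y2] [x0 y0 _ dom _]]] := gda_number2_zero_divisors g2; first by lia.
have [d [d0 d1]] : exists d : B, d != 0 /\ d != 1.
  have /existsP[d] : [exists d : B, d \notin [set 0; 1]].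
    rewrite -negb_forall; apply/forallP=> all01.
    have /subset_leq_card : [set: B] \subset [set 0; 1].
      by apply/subsetP => z _; apply: all01.
    by rewrite cardsT cardB cards2; case: (_ != _).
  by rewrite !inE negb_or => /andP[]; exists d.
have zdB (z : B) : z != 1 -> zero_divisor z.
  move=> z1; suff: z \in zdivs B by rewrite inE.
  suff -> : zdivs B = [set~ 1] by rewrite !inE.
  apply/eqP; rewrite eqEcard cardsC1 cardB ZB3 andbT; apply/subsetP => t.
  by rewrite !inE; apply: contraTneq => ->; rewrite zero_divisor1.
have zd1 : zero_divisor ((0, 1) : T) by rewrite zero_divisor_prod zero_divisor0.
have zd2 : zero_divisor ((1, d) : T) by rewrite zero_divisor_prod zdB ?orbT.
have zd3 : zero_divisor ((1, 1 - d) : T).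
  by rewrite zero_divisor_prod zdB ?orbT // -subr_eq0 addrAC subrr add0r oppr_eq0.
(* Any two of (0, 1), (1, d), (1, 1 - d) generate the unit ideal, so no two of
   them lie in a common proper annihilator. *)
have ann1 (z : T) : (0, 1) * z = 0 -> z.2 = 0.
  by case: z => u v [_]; rewrite mul1r.
have ann2 (z : T) e : (1, e) * z = 0 -> z.1 = 0 /\ e * z.2 = 0.
  by case: z => u v []; rewrite mul1r.
have both0 (z : T) : z.1 = 0 -> z.2 = 0 -> z = 0 by case: z => u v /= -> ->.
have no_common_ann1 (z : T) e : z != 0 -> (0, 1) * z = 0 -> (1, e) * z = 0 -> False.
  by move=> /eqP z0 /ann1 z2 /ann2[z1 _]; apply: z0; apply: both0.
have no_common_ann2 (z : T) : z != 0 -> (1, d) * z = 0 -> (1, 1 - d) * z = 0 -> False.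
  move=> /eqP z0 /ann2[z1 dz] /ann2[_]; rewrite mulrBl dz subr0 mul1r => z2.
  by apply: z0; apply: both0.
(* Pigeonhole: two of the three zero-divisors are killed by the same element of the dominating
   pair. *)
case: (dom _ zd1) => h1; case: (dom _ zd2) => h2.
- by case: (no_common_ann1 _ _ x0 h1 h2).
- by case: (dom _ zd3) => h3; [case: (no_common_ann1 _ _ x0 h1 h3) | case:
    (no_common_ann2 _ y0 h2 h3)].
- by case: (dom _ zd3) => h3; [case: (no_common_ann2 _ x0 h2 h3) | case:
    (no_common_ann1 _ _ y0 h1 h3)].
by case: (no_common_ann1 _ _ y0 h1 h2).
Qed.

End NonFieldFactor.

Section Classification.
Variable R : finComNzRingType.
Hypothesis g2 : gda_number (zero_divisor_graph R) = 2%N.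
Hypothesis Z_gt4 : (4 < #|zdivs R|)%N.

Definition classified : Prop :=
  [\/ two_part_rings R, ring_isomorphic R (GF4 * GF4)%type
    | ring_isomorphic R ('Z_2 * GF4)%type].

Lemma classify_field_prod (A B : finComNzRingType) : zd_free A -> zd_free B ->
  ring_isomorphic R (A * B)%type -> classified.
Proof.
wlog leAB : A B / (#|A| <= #|B|)%N.
  move=> IH domA domB RAB; have [|/ltnW] := leqP #|A| #|B|; first by move/IH; apply.
  by move/IH; apply=> //; apply: ring_isomorphic_trans RAB (ring_isomorphic_swap _ _).
move=> domA domB RAB; have RT : ring_isomorphic R (fin_prod A B) := RAB.
have gT := ring_isomorphic_gda_number RT; rewrite g2 in gT.
have /andP[leA leB] := field_factors_leq4 domA domB (gT isT).
have cardZ := card_zdivs_field_prod domA domB.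
rewrite -(ring_isomorphic_zdivs RT) in cardZ.
have A1 : (1 < #|A|)%N := card_finNzRing_gt1 A.
have iso (A' B' : nzRingType) : ring_isomorphic A A' -> ring_isomorphic B B' ->
    ring_isomorphic R (A' * B')%type.
  by move=> AA' BB'; apply: ring_isomorphic_trans RAB (ring_isomorphic_prod AA' BB').
(* More than four zero-divisors mean [#|A| + #|B| >= 6], with both orders at most 4. *)
have : [\/ #|A| = 2 /\ #|B| = 4, #|A| = 3 /\ #|B| = 3, #|A| = 3 /\ #|B| = 4
    | #|A| = 4 /\ #|B| = 4]%N.
  move: #|A| #|B| #|zdivs R| leA leB leAB cardZ Z_gt4 A1.
  move=> [|[|[|[|[|?]]]]] [|[|[|[|[|?]]]]] z; rewrite //= => *; 
   by [constructor 1 | constructor 2 | constructor 3 | constructor 4 | lia].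
case=> -[cardA cardB].
- by constructor 3; apply: iso; [apply: ring_isomorphic_Zp | apply: ring_isomorphic_GF4].
- by constructor 1; do 2!right; left; apply: iso; apply: ring_isomorphic_Zp.
- by constructor 1; do 3!right; left; apply: iso;
    [apply: ring_isomorphic_Zp | apply: ring_isomorphic_GF4].
by constructor 2; apply: iso; apply: ring_isomorphic_GF4.
Qed.

Lemma classify_nonfield_prod (A B : finComNzRingType) : ~~ zd_free B ->
  ring_isomorphic R (A * B)%type -> classified.
Proof.
move=> nfB RAB; have RT : ring_isomorphic R (fin_prod A B) := RAB.
have gT := ring_isomorphic_gda_number RT; rewrite g2 in gT.
have [cardA cardB ZB] := nonfield_factor_card nfB (gT isT).
have iso (B' : nzRingType) : ring_isomorphic B B' -> ring_isomorphic R ('Z_2 * B')%type.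
  move=> BB'; apply: ring_isomorphic_trans RAB (ring_isomorphic_prod _ BB').
  exact: ring_isomorphic_Zp.
have zdD (x y : B) : zero_divisor x -> zero_divisor y -> zero_divisor (x + y).
  move=> xz yz; have [->|x0] := eqVneq x 0; first by rewrite add0r.
  have [->|y0] := eqVneq y 0; first by rewrite addr0.
  (* [B] has a single nonzero zero-divisor, so the sum is x + x = x (1 + 1). *)
  suff -> : y = x by rewrite -[x]mulr1 -mulrDr zero_divisorMr.
  apply: contraTeq isT => neq_yx.
  have : (#|[set 0%R; x] :|: [set y]| <= #|zdivs B|)%N.
    apply/subset_leq_card/subsetP => z; rewrite !inE => /orP[/orP[]|] /eqP-> //.
    exact: zero_divisor0.
  by rewrite setUC cardsU1 !inE negb_or y0 neq_yx cards2 eq_sym x0 ZB.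
constructor 1; case: (local_prime_classification (isT : prime 2) ZB zdD) => /iso.
  by left.
by right; left.
Qed.

Lemma classification : classified.
Proof.
have [/forallP idem|] := boolP [forall e : R, (e * e == e) ==> (e == 0) || (e == 1)].
  have [|RZ|RZ] := @classify_local R g2 Z_gt4; last 2 first.
  - by constructor 1; do 4!right; left.
  - by constructor 1; do 5!right.
  by move=> e /eqP ee; have := idem e; rewrite ee => /orP[]/eqP; [left | right].
rewrite negb_forall => /existsP[e]; rewrite negb_imply negb_or.
case/andP=> /eqP ee /andP[e0 e1].
have [A [B RAB]] := idempotent_decomposition ee e0 e1.
have [domB|nfB] := boolP (zd_free B); last exact: (classify_nonfield_prod nfB RAB).
have [domA|nfA] := boolP (zd_free A); first exact: (classify_field_prod domA domB RAB).
apply: (classify_nonfield_prod nfA).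
exact: ring_isomorphic_trans RAB (ring_isomorphic_swap _ _).
Qed.

End Classification.

Theorem corollary3p22 (R : finComNzRingType)
    (hR : gda_number (zero_divisor_graph R) = 2%N) :
  (gda_partition_number (zero_divisor_graph R) = 2%N <->
     (ring_isomorphic R ('Z_2 * 'Z_4)%type \/
      ring_isomorphic R ('Z_2 * dual_numbers 'Z_2)%type \/
      ring_isomorphic R ('Z_3 * 'Z_3)%type \/
      ring_isomorphic R ('Z_3 * GF4)%type \/
      ring_isomorphic R 'Z_25 \/
      ring_isomorphic R (dual_numbers 'Z_5))) /\
  (gda_partition_number (zero_divisor_graph R) = 3%N <->
     ring_isomorphic R (GF4 * GF4)%type).
Proof.
have Z_gt4 : (1 < gda_partition_number (zero_divisor_graph R))%N -> (4 < #|zdivs R|)%N.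
  apply: contraTT; rewrite -!leqNgt card_zdivs ltnS => le3.
  by apply: gda_partition_number_le; rewrite hR; lia.
have psi2 := @two_part_rings_gda_partition_number R hR.
have psi3 := @GF4xGF4_gda_partition_number R hR.
have psi1 := @gda_partition_number_Z2xGF4 R hR.
split; split=> [psi|]; [|exact: psi2| |exact: psi3].
  (* The other classified rings have psi_g equal to 3 or at most 1, contradicting [psi]. *)
  have [||/psi3|/psi1] := @classification R hR; rewrite ?psi //.
  by apply: Z_gt4; rewrite psi.
have [|/psi2||/psi1] := @classification R hR; rewrite ?psi //.
by apply: Z_gt4; rewrite psi.
Qed.
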